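(* Every locally optimal control $\bar q\in\mathbb{Q}_{ad}$ satisfies the variational inequality $$(\lambda\bar q-\bar u\bar p,\,q-\bar q)_{L^2(\Omega)}\ge 0\qquad\forall q\in\mathbb{Q}_{ad},$$ where $\bar u=\mathcal{S}\bar q$ and $\bar p\in\tilde H^s(\Omega)$ is the unique solution of the adjoint equation $$\mathcal{A}(v,\bar p)+(\bar q\bar p,v)_{L^2(\Omega)}=(\bar u-u_\Omega,v)_{L^2(\Omega)}\qquad\forall v\in\tilde H^s(\Omega).$$
   Context: Setting: $d\ge 2$, $\Omega\subset\mathbb{R}^d$ is an open and bounded domain with Lipschitz boundary, $s\in(0,1)$, $\lambda>0$, $0<a<b$ are real numbers, and $f,u_\Omega\in L^2(\Omega)$. $\tilde H^s(\Omega)=\{v|_\Omega: v\in H^s(\mathbb{R}^d),\ \mathrm{supp}\,v\subset\bar\Omega\}$ (functions are identified with their extension by zero to $\mathbb{R}^d$). The bilinear form of the integral fractional Laplacian is $$\mathcal{A}(v,w)=\frac{C(d,s)}{2}\int_{\mathbb{R}^d}\int_{\mathbb{R}^d}\frac{(v(x)-v(y))(w(x)-w(y))}{|x-y|^{d+2s}}\,dx\,dy,\qquad C(d,s)=\frac{2^{2s}s\,\Gamma(s+\frac d2)}{\pi^{d/2}\Gamma(1-s)}.$$ $\mathbb{Q}_{ad}=\{v\in L^\infty(\Omega): a\le v(x)\le b \text{ for a.e. } x\in\Omega\}$. For $q\in\mathbb{Q}_{ad}$, $\mathcal{S}q=u\in\tilde H^s(\Omega)$ denotes the unique solution of $\mathcal{A}(u,v)+(qu,v)_{L^2(\Omega)}=(f,v)_{L^2(\Omega)}$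 for all $v\in\tilde H^s(\Omega)$. The cost functional is $J(u,q)=\frac12\|u-u_\Omega\|_{L^2(\Omega)}^2+\frac{\lambda}{2}\|q\|_{L^2(\Omega)}^2$. A control $\bar q\in\mathbb{Q}_{ad}$ is locally optimal (in the sense of $L^2(\Omega)$) if there is $\eta>0$ such that $J(\mathcal{S}\bar q,\bar q)\le J(\mathcal{S}q,q)$ for all $q\in\mathbb{Q}_{ad}$ with $\|q-\bar q\|_{L^2(\Omega)}\le\eta$. *)

(* Defs.v *)
From HB Require Import structures.
From mathcomp Require Import all_boot all_order all_algebra.
From mathcomp Require Import all_classical all_reals all_analysis.

Set Implicit Arguments.
Unset Strict Implicit.
Unset Printing Implicit Defensive.

Import Order.TTheory GRing.Theory Num.Theory.
Import numFieldNormedType.Exports.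

Local Open Scope classical_set_scope.
Local Open Scope ring_scope.

(* Points of R^d are the row vectors 'rV[R]_d, with their matrix topology (the
   usual topology of R^d) and the sigma-algebra generated by the coordinates
   (the Borel sigma-algebra of R^d). *)
Section measurable_rV.
Context {R : realType} (d : nat).

Definition rV_coord (i : 'I_d) (x : 'rV[R]_d) : R := x 0 i.

Let rV_set0 : g_sigma_preimage rV_coord set0.
Proof. exact: sigma_algebra0. Qed.

Let rV_setC A : g_sigma_preimage rV_coord A -> g_sigma_preimage rV_coord (~` A).
Proof. exact: sigma_algebraC. Qed.

Let rV_bigcup (F : (set 'rV[R]_d)^nat) :
  (forall i, g_sigma_preimage rV_coord (F i)) ->
  g_sigma_preimage rV_coord (\bigcup_i (F i)).
Proof. exact: sigma_algebra_bigcup. Qed.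

HB.instance Definition _ := @isMeasurable.Build
  (measure_tuple_display default_measure_display)
  'rV[R]_d (g_sigma_preimage rV_coord) rV_set0 rV_setC rV_bigcup.

Lemma measurable_rV_coord (i : 'I_d) :
  measurable_fun [set: 'rV[R]_d] (rV_coord i).
Proof.
move=> _ Y mY; rewrite setTI; apply: sub_sigma_algebra => /=.
rewrite -bigcup_seq/=; exists i => /=; first by rewrite mem_index_enum.
by exists Y => //; rewrite setTI.
Qed.

Lemma measurable_fun_rVP d1 (T : measurableType d1) (f : T -> 'rV[R]_d) :
  (forall i, measurable_fun [set: T] (rV_coord i \o f)) ->
  measurable_fun [set: T] f.
Proof.
move=> mf _ A mA; rewrite setTI.
suff : g_sigma_preimage (fun i => rV_coord i \o f) `<=` measurable.
  by rewrite g_sigma_preimage_comp; apply; exists A => //; rewrite setTI.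
apply: smallest_sub; first exact: sigma_algebra_measurable.
rewrite -bigcup_seq => B [i _ [C mC <-]].
exact: mf.
Qed.

End measurable_rV.

(* The Lebesgue measure of R^(n+1) is the image of the product of the Lebesgue
   measures of R and R^n under (t, x) |-> (t, x_1, .., x_n). *)
Section lebesgue_cons.
Context {R : realType} (n : nat).

Definition rV_cons (p : measurableTypeR R * 'rV[R]_n) : 'rV[R]_n.+1 :=
  row_mx (const_mx p.1 : 'rV[R]_1) p.2.

Lemma measurable_rV_cons : measurable_fun setT rV_cons.
Proof.
apply: measurable_fun_rVP => i.
have [j|j] := split_ordP (i : 'I_(1 + n)) => ->.
  rewrite (_ : _ \o _ = fst); first exact: measurable_fst.
  by apply/funext => p; rewrite /= /rV_coord [LHS]row_mxEl mxE.
rewrite (_ : _ \o _ = rV_coord j \o snd).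
  by apply: measurableT_comp; [exact: measurable_rV_coord|exact: measurable_snd].
by apply/funext => p; rewrite /= /rV_coord [LHS]row_mxEr.
Qed.

Variable mu : {sigma_finite_measure set 'rV[R]_n -> \bar R}.

Definition lebesgue_cons : set 'rV[R]_n.+1 -> \bar R :=
  pushforward (@lebesgue_measure R \x mu)%E rV_cons.

Let lebesgue_cons0 : lebesgue_cons set0 = 0%E.
Proof. by rewrite /lebesgue_cons /pushforward preimage_set0 measure0. Qed.

Let lebesgue_cons_ge0 A : (0 <= lebesgue_cons A)%E.
Proof. by rewrite /lebesgue_cons /pushforward; exact: measure_ge0. Qed.

Let lebesgue_cons_sigma_additive : semi_sigma_additive lebesgue_cons.
Proof.
have mc := measurable_rV_cons.
move=> F mF tF mUF; rewrite /lebesgue_cons /pushforward preimage_bigcup.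
apply: measure_semi_sigma_additive.
- by move=> k; rewrite -[X in measurable X]setTI; exact: mc.
- apply/trivIsetP => /= i j _ _ ij; rewrite -preimage_setI.
  by move/trivIsetP : tF => /(_ _ _ _ _ ij) ->//; rewrite preimage_set0.
- by rewrite -preimage_bigcup -[X in measurable X]setTI; exact: mc.
Qed.

HB.instance Definition _ := isMeasure.Build _ _ _ lebesgue_cons
  lebesgue_cons0 lebesgue_cons_ge0 lebesgue_cons_sigma_additive.

Let rV_uncons (x : 'rV[R]_n.+1) : measurableTypeR R * 'rV[R]_n :=
  (x 0 ord0, rsubmx (x : 'rV[R]_(1 + n))).

Let rV_consK : cancel rV_cons rV_uncons.
Proof.
move=> [t x]; rewrite /rV_uncons /rV_cons row_mxKr; congr pair.
rewrite (_ : ord0 = lshift n (ord0 : 'I_1)); last exact/val_inj.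
by rewrite [LHS]row_mxEl mxE.
Qed.

Let measurable_rV_uncons : measurable_fun setT rV_uncons.
Proof.
apply/measurable_fun_pairP; split.
  exact: (measurable_rV_coord ord0).
apply: measurable_fun_rVP => i.
rewrite (_ : _ \o _ = @rV_coord R n.+1 (rshift 1 i)).
  exact: measurable_rV_coord.
by apply/funext => x; rewrite /= /rV_coord mxE.
Qed.

Let lebesgue_cons_sigma_finite : sigma_finite setT lebesgue_cons.
Proof.
have /sigma_finiteP[F [TF ndF Foo]] := sigma_finiteT (@lebesgue_measure R).
have /sigma_finiteP[G [TG ndG Goo]] := sigma_finiteT mu.
exists (fun k => rV_uncons @^-1` (F k `*` G k)).
  rewrite -preimage_bigcup (_ : \bigcup_k _ = setT) ?preimage_setT//.
  rewrite -setXTT TF TG predeqE => -[x y]; split.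
    by move=> [k _ []/= ? ?]; split; exists k.
  move=> [/= [k _ Fkx] [l _ Gly]]; exists (maxn k l) => //; split.
  - by move: x Fkx; exact/subsetPset/ndF/leq_maxl.
  - by move: y Gly; exact/subsetPset/ndG/leq_maxr.
move=> k; have [mF Fk] := Foo k; have [mG Gk] := Goo k; split.
  by rewrite -[X in measurable X]setTI; apply: measurable_rV_uncons => //;
    exact: measurableX.
rewrite /lebesgue_cons /pushforward (_ : rV_cons @^-1` _ = F k `*` G k).
  by rewrite product_measure1E// lte_mul_pinfty// ge0_fin_numE.
by apply/seteqP; split => p; rewrite /preimage /mkset rV_consK.
Qed.

HB.instance Definition _ := Measure_isSigmaFinite.Build _ _ _ lebesgue_cons
  lebesgue_cons_sigma_finite.

End lebesgue_cons.

Fixpoint lebesgue_rV (R : realType) (d : nat) :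
    {sigma_finite_measure set 'rV[R]_d -> \bar R} :=
  if d is n.+1 then lebesgue_cons (lebesgue_rV R n) else \d_(0 : 'rV[R]_0).

Lemma lebesgue_rV_box (R : realType) (d : nat) (A : 'I_d -> set R) :
  (forall i, measurable (A i)) ->
  lebesgue_rV R d [set x | forall i, A i (x 0 i)] =
  (\prod_(i < d) @lebesgue_measure R (A i))%E.
Proof.
elim: d A => [|n IH] A mA.
  by rewrite big_ord0 /= diracE mem_set// => -[].
have mB : measurable [set x : 'rV[R]_n | forall i, A (lift ord0 i) (x 0 i)].
  rewrite (_ : mkset _ = \bigcap_(i in [set: 'I_n])
      (rV_coord i @^-1` A (lift ord0 i) : set 'rV[R]_n)).
    apply: fin_bigcap_measurable => [|i _]; first exact: finite_finset.
    by rewrite -[X in measurable X]setTI; exact: measurable_rV_coord.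
  by apply/seteqP; split=> [x xA i _|x xA i]; exact: xA.
rewrite big_ord_recl -IH//= /lebesgue_cons /pushforward.
rewrite -product_measure1E//; last exact: (mA ord0).
have E0 (p : measurableTypeR R * 'rV[R]_n) : rV_cons p 0 ord0 = p.1.
  rewrite (_ : ord0 = lshift n (ord0 : 'I_1)); last exact/val_inj.
  by rewrite [LHS]row_mxEl mxE.
have ES (p : measurableTypeR R * 'rV[R]_n) i :
    rV_cons p 0 (lift ord0 i) = p.2 0 i.
  rewrite (_ : lift ord0 i = rshift 1 i); last exact/val_inj.
  by rewrite [LHS]row_mxEr.
congr (_ _); apply/seteqP; split=> p /=.
  by move=> pA; split=> [|i]; [rewrite -E0|rewrite -ES]; exact: pA.
move=> [p1 p2] i; have [j ->|->] := unliftP ord0 i; last by rewrite E0.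
by rewrite ES; exact: p2.
Qed.

Section lipschitz_domain.
Context {R : realType} {d : nat}.

Definition boundary (Omega : set 'rV[R]_d) := closure Omega `\` interior Omega.

(* Near each of its boundary points, Omega is the strict epigraph of a Lipschitz
   function of d - 1 variables in some orthonormal coordinate system: the
   coordinates of x are the entries of x *m O, the i-th one is the vertical one
   and col' i removes it. *)
Definition lipschitz_boundary (Omega : set 'rV[R]_d) :=
  forall x0, boundary Omega x0 ->
  exists (O : 'M[R]_d) (i : 'I_d) (g : 'rV[R]_d.-1 -> R^o),
    [/\ O *m O^T = 1%:M,
        lipschitz g &
        \forall x \near x0,
          Omega x <-> g (col' i (x *m O)) < (x *m O) 0 i].

Definition bounded_lipschitz_domain (Omega : set 'rV[R]_d) :=
  [/\ open Omega, connected Omega, Omega !=set0,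
      bounded_set Omega & lipschitz_boundary Omega].

End lipschitz_domain.

Section fractional_laplacian.
Context {R : realType} {d : nat}.
Implicit Types (s : R) (Omega : set 'rV[R]_d) (f g q u v w : 'rV[R]_d -> R).
Local Notation leb := (lebesgue_rV R d).

(* The norm `|x| of 'rV[R]_d is the sup norm. *)
Definition enorm (x : 'rV[R]_d) : R := Num.sqrt (\sum_(i < d) x 0 i ^+ 2).

(* Elements of Lebesgue spaces are represented by Borel functions on R^d, which
   matter on Omega only; f \_ Omega is the extension by zero of f from Omega. *)
Definition L2 Omega : set ('rV[R]_d -> R) :=
  [set f | f \_ Omega \in Lfun leb 2%:E].

Definition Loo Omega : set ('rV[R]_d -> R) :=
  [set f | f \_ Omega \in Lfun leb +oo%E].

Definition L2dot Omega f g : R := \int[leb]_(x in Omega) (f x * g x).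

Definition L2norm Omega f : R := fine ('N[leb]_2%:E [EFin \o (f \_ Omega)])%E.

Definition gagliardo_finite s v : Prop :=
  (\int[leb]_y \int[leb]_x
     (`|v x - v y| ^+ 2 / enorm (x - y) `^ (d%:R + 2 * s))%:E < +oo)%E.

Definition Hs s : set ('rV[R]_d -> R) :=
  [set v | L2 setT v /\ gagliardo_finite s v].

(* The support of a class of functions modulo equality almost everywhere. *)
Definition ess_support v : set 'rV[R]_d :=
  ~` \bigcup_(U in [set U | open U /\ v = cst 0 %[ae leb in U]]) U.

(* Restrictions to Omega, identified with their extension by zero. *)
Definition Htilde s Omega : set ('rV[R]_d -> R) :=
  [set v \_ Omega | v in [set v | Hs s v /\ ess_support v `<=` closure Omega]].

Definition Gamma (z : R) : R :=
  \int[@lebesgue_measure R]_(t in `]0, +oo[) (t `^ (z - 1) * expR (- t)).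

Definition fracC s : R :=
  2 `^ (2 * s) * s * Gamma (s + d%:R / 2) / (pi `^ (d%:R / 2) * Gamma (1 - s)).

(* The integrand is integrable on R^d x R^d for v and w in H^s(R^d), so that the
   value infinity, which fine would turn into 0, does not arise. *)
Definition fracA s v w : R :=
  fracC s / 2 *
  fine (\int[leb]_y \int[leb]_x
          ((v x - v y) * (w x - w y) / enorm (x - y) `^ (d%:R + 2 * s))%:E)%E.

End fractional_laplacian.

Section control_problem.
Context {R : realType} {d : nat}.
Variables (s : R) (Omega : set 'rV[R]_d).
Implicit Types (f uOmega q u p : 'rV[R]_d -> R).
Local Notation leb := (lebesgue_rV R d).

Definition Qad (a b : R) : set ('rV[R]_d -> R) :=
  [set q | Loo Omega q /\ {ae leb, forall x, Omega x -> a <= q x <= b}].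

Definition is_state f q u : Prop :=
  Htilde s Omega u /\
  forall v, Htilde s Omega v ->
    fracA s u v + L2dot Omega (q \* u) v = L2dot Omega f v.

(* A representative of the solution, which is unique up to equality almost
   everywhere. *)
Definition control_to_state f q : 'rV[R]_d -> R := xget (cst 0) (is_state f q).

Definition is_adjoint uOmega q u p : Prop :=
  Htilde s Omega p /\
  forall v, Htilde s Omega v ->
    fracA s v p + L2dot Omega (q \* p) v = L2dot Omega (u \- uOmega) v.

Definition cost (lambda : R) uOmega u q : R :=
  2^-1 * L2norm Omega (u \- uOmega) ^+ 2 + lambda / 2 * L2norm Omega q ^+ 2.

Definition locally_optimal (lambda a b : R) f uOmega qbar : Prop :=
  Qad a b qbar /\
  exists2 eta : R, 0 < eta &
    forall q, Qad a b q -> L2norm Omega (q \- qbar) <= eta ->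
      cost lambda uOmega (control_to_state f qbar) qbar <=
      cost lambda uOmega (control_to_state f q) q.

End control_problem.

(* Main.v *)
(* The fractional energy space on Omega, normed by the L^2 norms of u and of
   (u(x) - u(y)) |x - y|^(-d/2-s), is complete, and the form
   B_q(u, v) = A(u, v) + (q u, v) is coercive on it for q >= a > 0; this yields
   the state and the adjoint state by minimization of a quadratic functional.
   The boundary of a Lipschitz domain is a null set, so restricting a function
   with support in the closure of Omega to Omega leaves its energy unchanged.
   For q_t = qbar + t (q - qbar) and w = u_t - ubar, testing the equations gives
   |w| = O(t) and (ubar - u_Omega, w) = - t ((q - qbar) u_t, pbar).  Hence
   J(u_t, q_t) - J(ubar, qbar) is t (lambda qbar - ubar pbar, q - qbar) + O(t^2),
   and local optimality makes the first-order term nonnegative. *)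
Require Import Defs.
From mathcomp Require Import all_boot all_order all_algebra.
From mathcomp Require Import all_classical all_reals all_analysis measurable_realfun.
From mathcomp Require Import ring lra.
Import Order.TTheory GRing.Theory Num.Theory.
Import numFieldNormedType.Exports.
Set Implicit Arguments.
Unset Strict Implicit.
Unset Printing Implicit Defensive.
Local Open Scope classical_set_scope.
Local Open Scope ring_scope.

(** * Riesz representation *)

(** The map from control to state is never differentiated: exact identities for w replace
    derivatives. They first produce h u_t with h = q - qbar; replacing u_t by ubar costs t (h w,
    pbar), which is of second order because |w| = O(t). The resulting constant may depend on ubar
    and pbar but not on t or u_t. Function spaces consist of actual functions, so almost everywhere
    conditions are made pointwise: a control is replaced by a measurable [Q] with values in [a, b]
    on all of R^d, and the state space by the finite energy functions that vanish at every point
    outside Omega. Since a > 0, the zero-order term controls the L^2 norm and no Poincaré inequality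
    is involved. Completeness is used along sequences with squared distances 16^-n: weighting
    squared increments by 4^n leaves a summable series and pointwise increments of order 2^-n.
    Coercivity requires C(d,s) > 0. This includes convergence of the Gamma integrals, because a
    divergent integral would be read as 0. *)

Lemma le_geometric_eq0 (R : realType) (x C : R) : (forall n, `|x| <= C * 4^-1 ^+ n) -> x = 0.
Proof.
move=> xC; apply/eqP; rewrite -normr_eq0; apply/eqP/le_anti.
rewrite normr_ge0 andbT.
have cvgC : (fun n => C * 4^-1 ^+ n) @ \oo --> (C * 0 : R).
  apply: cvgMl_tmp; apply: cvg_expr; rewrite ger0_norm ?invr_ge0//.
  by rewrite invf_lt1// ltr1n.
rewrite mulr0 in cvgC.
rewrite -(cvg_lim (@Rhausdorff R) cvgC).
by apply: limr_ge; [apply/cvg_ex; exists 0|exact: nearW].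
Qed.

Section riesz.
Context {R : realType} {T : Type} (H : set (T -> R)) (B : (T -> R) -> (T -> R) -> R)
  (l : (T -> R) -> R).
Implicit Types u v w : T -> R.

Hypothesis H0 : H (fun=> 0).
Hypothesis HD : forall u v t, H u -> H v -> H (fun x => u x + t * v x).
Hypothesis BC : forall u v, H u -> H v -> B u v = B v u.
Hypothesis BD : forall u v w t, H u -> H v -> H w ->
  B (fun x => u x + t * v x) w = B u w + t * B v w.
Hypothesis lD : forall u v t, H u -> H v ->
  l (fun x => u x + t * v x) = l u + t * l v.
Hypothesis B_ge0 : forall u, H u -> 0 <= B u u.

Lemma form_sqrD u v t : H u -> H v ->
  B (fun x => u x + t * v x) (fun x => u x + t * v x) =
  B u u + 2 * t * B u v + t ^+ 2 * B v v.
Proof.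
move=> Hu Hv; have Huv := HD t Hu Hv.
rewrite BD// (BC Hu Huv) (BC Hv Huv) !BD// (BC Hv Hu); ring.
Qed.

Lemma form_young u v t : 0 < t -> H u -> H v ->
  `|2 * B u v| <= t^-1 * B u u + t * B v v.
Proof.
move=> t0 Hu Hv.
have t1 : 0 <= t^-1 by rewrite invr_ge0 ltW.
have tt : t^-1 * t = 1 by rewrite mulVf// gt_eqF.
have p := mulr_ge0 t1 (B_ge0 (HD t Hu Hv)).
have m := mulr_ge0 t1 (B_ge0 (HD (- t) Hu Hv)).
rewrite form_sqrD// in p; rewrite form_sqrD// in m.
have E1 : t^-1 * (B u u + 2 * t * B u v + t ^+ 2 * B v v) =
  t^-1 * B u u + 2 * B u v * (t^-1 * t) + t * B v v * (t^-1 * t) by ring.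
have E2 : t^-1 * (B u u + 2 * - t * B u v + (- t) ^+ 2 * B v v) =
  t^-1 * B u u - 2 * B u v * (t^-1 * t) + t * B v v * (t^-1 * t) by ring.
rewrite E1 tt in p; rewrite E2 tt in m.
by rewrite ler_norml; apply/andP; split; lra.
Qed.

Hypothesis l_bounded : exists K, forall u, H u -> - K <= B u u - 2 * l u.
(** Only fast Cauchy sequences are considered. The loss of a constant [C] in the limit allows [B] to
    be merely equivalent to the norm in which the limit is taken. *)
Hypothesis complete : forall v_ : (T -> R)^nat, (forall n, H (v_ n)) ->
  (forall n m, (n <= m)%N ->
    B (fun x => v_ m x + -1 * v_ n x) (fun x => v_ m x + -1 * v_ n x)
      <= 16^-1 ^+ n) ->
  exists C : R, exists2 v, H v &
    forall n, B (fun x => v x + -1 * v_ n x) (fun x => v x + -1 * v_ n x)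
      <= C * 16^-1 ^+ n.

(* The functional [B u u - 2 l u] is minimized; the parallelogram law makes
   minimizing sequences Cauchy. *)
Lemma riesz_representation : exists2 u, H u & forall w, H w -> B u w = l w.
Proof.
pose Phi u := B u u - 2 * l u.
pose S := Phi @` H.
have infS : has_inf S.
  split; first by exists (Phi (fun=> 0)), (fun=> 0).
  by have [K KP] := l_bounded; exists (- K) => _ [u Hu <-]; exact: KP.
have Pmin u : H u -> inf S <= Phi u.
  by move=> Hu; apply: ge_inf; [case: infS|exists u].
have e0 n : 0 < 16^-1 ^+ n / 4 :> R by rewrite divr_gt0// exprn_gt0// invr_gt0.
have /choice[v_ v_P] n : exists u, H u /\ Phi u <= inf S + 16^-1 ^+ n / 4.
  have [_ [u Hu <-] uP] := inf_adherent (e0 n) infS.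
  by exists u; split => //; exact: ltW.
have Hv n : H (v_ n) by have [] := v_P n.
have Pv n : Phi (v_ n) <= inf S + 16^-1 ^+ n / 4 by have [] := v_P n.
have PhiD u w t : H u -> H w -> Phi (fun x => u x + t * w x) =
    Phi u + 2 * t * (B u w - l w) + t ^+ 2 * B w w.
  by move=> Hu Hw; rewrite /Phi form_sqrD// lD//; ring.
have [|C [v Hlim vC]] := complete Hv.
  move=> n m nm.
  have e_mn : 16^-1 ^+ m <= 16^-1 ^+ n :> R.
    by rewrite ler_wiXn2l ?invr_ge0// invf_le1// ler1n.
  have Hd := HD (-1) (Hv m) (Hv n).
  (* The midpoint of [v_ n] and [v_ m] has value at least the infimum, so [bb] is at most twice the
     sum of the two excesses. Excesses of at most a quarter of the tolerance give 16^-n. *)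
  have := Pmin _ (HD 2^-1 (Hv n) Hd); rewrite PhiD//.
  have := Pv m.
  have -> : Phi (v_ m) = Phi (fun x => v_ n x + 1 * (v_ m x + -1 * v_ n x)).
    by congr Phi; apply/funext => x; ring.
  rewrite PhiD//; have := Pv n; set bb := B (fun x => _) (fun x => _).
  by set bl := B _ _ - l _; move: (Phi (v_ n)) (inf S) => P I; lra.
exists v => // w Hw; apply/eqP; rewrite -subr_eq0; apply/eqP.
apply: (@le_geometric_eq0 R _ (C + 1 + 2 * B w w)) => n.
have r0 : 0 < 4^-1 ^+ n :> R by rewrite exprn_gt0// invr_gt0.
have r2 : 16^-1 ^+ n = (4^-1 ^+ n) ^+ 2 :> R.
  by rewrite -exprM mulnC exprM expr2 -invfM -natrM.
have Hd := HD (-1) Hlim (Hv n).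
have := form_young r0 Hd Hw.
rewrite BD//.
(* Moving [v_ n] by 4^-n w in either direction, where 4^-n is the square root of the tolerance,
   lowers [Phi] by at most 16^-n / 4. The first variation at [v_ n] is thus O(4^-n), and Young's
   inequality with the same weight carries this over to [v]. *)
have p1 := Pmin _ (HD (4^-1 ^+ n) (Hv n) Hw).
have p2 := Pmin _ (HD (- 4^-1 ^+ n) (Hv n) Hw).
rewrite !PhiD// in p1 p2.
have := Pv n; have := vC n; have := B_ge0 Hd; have := B_ge0 Hw.
rewrite r2; move: p1 p2 r0.
move: (4^-1 ^+ n) => r.
set dd := B (fun x => v x + _) (fun x => v x + _).
set bw := B w w; set bvw := B v w; set bnw := B (v_ n) w.
set lw := l w; set P := Phi (v_ n); set I := inf S.
move=> p1 p2 r0 bw0 dd0 ddC PI.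
have {}p1 : - r / 4 <= 2 * (bnw - lw) + r * bw.
  by rewrite -(ler_pM2l r0); nra.
have {}p2 : - r / 4 <= - 2 * (bnw - lw) + r * bw.
  by rewrite -(ler_pM2l r0); nra.
have ddr : r^-1 * dd <= C * r.
  by rewrite ler_pdivrMl//; nra.
rewrite ler_norml => /andP[q1 q2].
by rewrite ler_norml; apply/andP; split; lra.
Qed.

End riesz.

(** * Square-integrable functions *)

Section square_integrable.
Context d (T : measurableType d) (R : realType) (mu : {measure set T -> \bar R}).
Implicit Types f g : T -> R.

Definition ip f g : R := \int[mu]_x (f x * g x).

Lemma Lnorm2_sqr f :
  ('N[mu]_2%:E [EFin \o f] `^ 2 = \int[mu]_x (f x ^+ 2)%:E)%E.
Proof.
rewrite powR_Lnorm//; apply: eq_integral => x _ /=.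
by rewrite powR_mulrn// real_normK// num_real.
Qed.

Lemma Lfun2P f : f \in Lfun mu 2%:E <->
  measurable_fun setT f /\ (\int[mu]_x (f x ^+ 2)%:E < +oo)%E.
Proof.
rewrite -Lnorm2_sqr inE; split => [/andP[]|[mf foo]].
  rewrite !inE /= => mf foo; split => //.
  exact: poweR_lty.
apply/andP; split; rewrite !inE//=.
rewrite /finite_norm.
by apply: lty_poweRy foo.
Qed.

Lemma Lfun2_measurable f : f \in Lfun mu 2%:E -> measurable_fun setT f.
Proof. by move=> /Lfun2P[]. Qed.

Lemma Lfun2_lin f g t : f \in Lfun mu 2%:E -> g \in Lfun mu 2%:E ->
  (fun x => f x + t * g x) \in Lfun mu 2%:E.
Proof.
move=> Lf Lg; have h : (1 <= 2%:E :> \bar R)%E by rewrite lee_fin ler1n.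
have [_] := Lfun_submod_closed mu h; move=> /(_ t g f Lg Lf).
rewrite (_ : (_ + f) = (fun x => f x + t * g x))//.
by apply/funext => x; rewrite /= addrC.
Qed.

Lemma Lfun2_dom f g C : measurable_fun setT f -> g \in Lfun mu 2%:E ->
  {ae mu, forall x, `|f x| <= C * `|g x|} -> f \in Lfun mu 2%:E.
Proof.
move=> mf /[dup] /Lfun2_measurable mg Lg fg; apply/Lfun2P; split => //.
have iC : mu.-integrable setT (EFin \o (fun x => (C ^+ 2) * g x ^+ 2)).
  by apply/(@integrableZl _ _ _ _ _ measurableT _
    (EFin \o (fun x => g x ^+ 2)))/Lfun2_integrable_sqr.
apply: (@le_lt_trans _ _ (\int[mu]_x (C ^+ 2 * g x ^+ 2)%:E)%E).
  apply: ae_ge0_le_integral => //.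
  - by move=> x _; rewrite lee_fin sqr_ge0.
  - by apply/measurable_EFinP; exact: measurable_funX.
  - by move=> x _; rewrite lee_fin mulr_ge0// sqr_ge0.
  - by apply/measurable_EFinP; apply: measurable_funM => //; exact: measurable_funX.
  - apply: filterS fg => x fg _; rewrite lee_fin -exprMn.
    rewrite -[f x ^+ 2]real_normK ?num_real// -[(C * g x) ^+ 2]real_normK ?num_real//.
    rewrite ler_sqr ?nnegrE// normrM; apply: (le_trans fg).
    by rewrite ler_wpM2r// ler_norm.
exact: integrable_lty iC.
Qed.

Lemma ip_integrable f g : f \in Lfun mu 2%:E -> g \in Lfun mu 2%:E ->
  mu.-integrable setT (EFin \o (fun x => f x * g x)).
Proof. by move=> Lf Lg; apply/Lfun1_integrable; exact: Lfun2_mul_Lfun1. Qed.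

Lemma ipC f g : ip f g = ip g f.
Proof. by apply: eq_Rintegral => x _; rewrite mulrC. Qed.

Lemma ip_linl f g h t : f \in Lfun mu 2%:E -> g \in Lfun mu 2%:E ->
  h \in Lfun mu 2%:E -> ip (fun x => f x + t * g x) h = ip f h + t * ip g h.
Proof.
move=> Lf Lg Lh; rewrite /ip.
under eq_Rintegral do rewrite mulrDl -mulrA.
rewrite RintegralD ?RintegralZl//; try exact: ip_integrable.
by apply/(@integrableZl _ _ _ _ _ measurableT _ (EFin \o (g \* h)))/ip_integrable.
Qed.

Lemma ip_linr f g h t : f \in Lfun mu 2%:E -> g \in Lfun mu 2%:E ->
  h \in Lfun mu 2%:E -> ip h (fun x => f x + t * g x) = ip h f + t * ip h g.
Proof. by move=> Lf Lg Lh; rewrite ipC ip_linl// ipC (ipC g). Qed.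

Lemma ip_ge0 f : 0 <= ip f f.
Proof. by apply: Rintegral_ge0 => x _; rewrite -expr2 sqr_ge0. Qed.

Lemma Lfun2_scale f t : f \in Lfun mu 2%:E -> (fun x => t * f x) \in Lfun mu 2%:E.
Proof.
move=> Lf; apply: (@Lfun2_dom _ f `|t|) => //.
  by apply: measurable_funM => //; exact: Lfun2_measurable.
by apply: aeW => x; rewrite normrM.
Qed.

Lemma ip_scale_sqr f t : f \in Lfun mu 2%:E ->
  ip (fun x => t * f x) (fun x => t * f x) = t ^+ 2 * ip f f.
Proof.
move=> Lf; rewrite /ip -RintegralZl//; last exact: ip_integrable.
by apply: eq_Rintegral => x _; ring.
Qed.

Lemma ip_sqrE f : f \in Lfun mu 2%:E ->
  ((ip f f)%:E = \int[mu]_x (f x ^+ 2)%:E)%E.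
Proof.
move=> /Lfun2P[mf foo]; rewrite /ip /Rintegral fineK.
  by apply: eq_integral => x _; rewrite expr2.
rewrite ge0_fin_numE; last by apply: integral_ge0 => x _; rewrite lee_fin -expr2 sqr_ge0.
by under eq_integral do rewrite -expr2.
Qed.

Lemma ip_eq0 f : f \in Lfun mu 2%:E -> ip f f = 0 -> {ae mu, forall x, f x = 0}.
Proof.
move=> Lf f0; have mf := Lfun2_measurable Lf.
have := ip_sqrE Lf; rewrite f0 => /esym E.
have : (\int[mu]_x `|(f x ^+ 2)%:E| = 0)%E.
  by rewrite -[RHS]E; apply: eq_integral => x _; rewrite gee0_abs// lee_fin sqr_ge0.
move/ae_eq_integral_abs => /(_ measurableT).
have m2 : measurable_fun setT (fun x => (f x ^+ 2)%:E).
  by apply/measurable_EFinP; exact: measurable_funX.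
move=> /(_ m2); apply: filterS => x /(_ I) /= [] /eqP.
by rewrite sqrf_eq0 => /eqP.
Qed.

Lemma Lfun2_ae_eq f g : measurable_fun setT g -> f \in Lfun mu 2%:E ->
  {ae mu, forall x, f x = g x} -> g \in Lfun mu 2%:E.
Proof.
move=> mg Lf fg; apply: (@Lfun2_dom _ f 1) => //.
by apply: filterS fg => x ->; rewrite mul1r.
Qed.

(** Passes L^2 bounds to almost everywhere limits with no integrable majorant. *)
Lemma fatou_sqr (f_ : (T -> R)^nat) f C :
  (forall n, measurable_fun setT (f_ n)) -> measurable_fun setT f ->
  {ae mu, forall x, f_ ^~ x @ \oo --> f x} ->
  (forall n, \int[mu]_x (f_ n x ^+ 2)%:E <= C)%E ->
  (\int[mu]_x (f x ^+ 2)%:E <= C)%E.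
Proof.
move=> mf_ mf fcvg fC.
have m2 g : measurable_fun setT g -> measurable_fun setT (fun x => (g x ^+ 2)%:E).
  by move=> mg; apply/measurable_EFinP; exact: measurable_funX.
rewrite (ge0_ae_eq_integral (g := fun x => limn_einf (fun n => (f_ n x ^+ 2)%:E)))//.
- apply: le_trans; first apply: fatou => //.
    by move=> n; exact: m2.
    by move=> n x _; rewrite lee_fin sqr_ge0.
  rewrite limn_einf_lim; apply: lime_le; first exact: is_cvg_einfs.
  apply: nearW => n; apply: le_trans (fC n).
  by apply: ereal_inf_lbound; exists n => /=.
- exact: m2.
- rewrite (_ : (fun x => _) = fun x => - limn_esup (fun n => - (f_ n x ^+ 2)%:E))%E.
    apply: measurableT_comp => //; apply: measurable_fun_limn_esup => n.
    by apply: measurableT_comp => //; exact: m2.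
  apply/funext => x; rewrite -limn_einfN; congr limn_einf.
  by apply/funext => n; rewrite /= opprK.
- by move=> x _; rewrite lee_fin sqr_ge0.
- move=> x _; rewrite limn_einf_lim; apply: lime_ge; first exact: is_cvg_einfs.
  apply: nearW => n; apply: le_ereal_inf_tmp => _ [k /= nk <-].
  by rewrite lee_fin sqr_ge0.
- apply: filterS fcvg => x fcvg _.
  have c2 : (f_ n x ^+ 2)%:E @[n --> \oo] --> (f x ^+ 2)%:E.
    apply: cvg_EFin; first exact: nearW.
    rewrite (_ : _ \o _ = fun n => f_ n x ^+ 2)//.
    by rewrite expr2; under eq_fun do rewrite expr2; exact: cvgM.
  by rewrite is_cvg_limn_einfE//; [exact/esym/cvg_lim|apply/cvg_ex; eexists; exact: c2].
Qed.

End square_integrable.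

(** * Pointwise limits of fast Cauchy sequences *)

Section fast_cauchy.
Context d (T : measurableType d) (R : realType) (mu : {measure set T -> \bar R}).
Variable u_ : (T -> R)^nat.
Hypothesis mu_ : forall n, measurable_fun setT (u_ n).
Variable C : R.
Hypothesis u_C : forall n,
  (\int[mu]_x ((u_ n.+1 x - u_ n x) ^+ 2)%:E <= (C * 16^-1 ^+ n)%:E)%E.

(* The series of the 4^n (u_(n+1) - u_n)^2 is integrable, hence finite almost
   everywhere, so that u_(n+1) - u_n is O(2^-n). *)
Lemma fast_cauchy_ae_cvg : {ae mu, forall x, cvgn (u_ ^~ x)}.
Proof.
have C0 : 0 <= C.
  have := u_C 0; rewrite expr0 mulr1 -lee_fin; apply: le_trans.
  by apply: integral_ge0 => x _; rewrite lee_fin sqr_ge0.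
pose g n x := (4 ^+ n * (u_ n.+1 x - u_ n x) ^+ 2)%:E.
have g0 n x : (0 <= g n x)%E by rewrite lee_fin mulr_ge0 ?sqr_ge0 ?exprn_ge0.
have mg n : measurable_fun setT (g n).
  apply/measurable_EFinP; apply: measurable_funM => //.
  by apply: measurable_funX; exact: measurable_funB.
have gint : (\int[mu]_x (\sum_(n <oo) g n x) < +oo)%E.
  rewrite integral_nneseries//.
  apply: (@le_lt_trans _ _ (\sum_(n <oo) (C * 4^-1 ^+ n)%:E)%E).
    apply: lee_nneseries => [n _ _|n _]; first exact: integral_ge0.
    under eq_integral do rewrite /g EFinM.
    rewrite ge0_integralZl//; last 2 first.
    - by apply/measurable_EFinP; apply: measurable_funX; exact: measurable_funB.
    - by move=> x _; rewrite lee_fin sqr_ge0.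
    apply: (@le_trans _ _ ((4 ^+ n)%:E * (C * 16^-1 ^+ n)%:E)%E).
      by rewrite lee_wpmul2l ?lee_fin ?exprn_ge0.
    rewrite -EFinM lee_fin mulrCA -exprMn.
    by rewrite (_ : 4 * 16^-1 = 4^-1)//; lra.
  have cg : cvgn (series (geometric C 4^-1)).
    apply: is_cvg_geometric_series; rewrite ger0_norm ?invr_ge0//.
    by rewrite invf_lt1// ltr1n.
  rewrite (_ : (\sum_(n <oo) _)%E = (limn (series (geometric C 4^-1)))%:E) ?ltry//.
  rewrite -EFin_lim//; congr (limn _); apply/funext => n /=.
  by rewrite /series/= sumEFin.
have gfin : {ae mu, forall x, (\sum_(n <oo) g n x < +oo)%E}.
  have ig : mu.-integrable setT (fun x => \sum_(n <oo) g n x)%E.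
    apply/integrableP; split.
      by apply: ge0_emeasurable_sum => // k x _ _; exact: g0.
    under eq_integral do rewrite gee0_abs ?nneseries_ge0//.
    exact: gint.
  have := integrable_ae measurableT ig.
  apply: filterS => x /(_ I); rewrite ge0_fin_numE// nneseries_ge0//.
apply: filterS gfin => x gx.
pose s := fine (\sum_(n <oo) g n x)%E.
have s_n n : 4 ^+ n * (u_ n.+1 x - u_ n x) ^+ 2 <= s.
  rewrite -lee_fin fineK; last by rewrite ge0_fin_numE// nneseries_ge0.
  rewrite (nneseries_split 0 n.+1)// big_nat_recr//=.
  rewrite -addeA [leRHS]addeC -[leLHS]adde0 -addeA add0n leeD//.
  by rewrite adde_ge0// ?nneseries_ge0// sume_ge0.
have s0 : 0 <= s by apply: le_trans (s_n 0); rewrite mulr_ge0// sqr_ge0.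
(* Bounding s by (1 + s)^2 avoids its square root. *)
have dn n : `|u_ n.+1 x - u_ n x| <= (1 + s) * 2^-1 ^+ n.
  rewrite -ler_sqr ?nnegrE ?mulr_ge0 ?addr_ge0 ?exprn_ge0 ?invr_ge0//.
  rewrite real_normK ?num_real// exprMn -exprM mulnC exprM.
  rewrite (_ : 2^-1 ^+ 2 = 4^-1 :> R); last by rewrite expr2 -invfM -natrM.
  rewrite exprVn ler_pdivlMr ?exprn_gt0// mulrC (le_trans (s_n n))//.
  by nra.
have cs : cvgn (series (fun n => u_ n.+1 x - u_ n x)).
  apply: normed_cvg.
  apply: (@series_le_cvg _ _ (geometric (1 + s) 2^-1)) => [n|n||].
  - exact: normr_ge0.
  - by rewrite /= mulr_ge0 ?addr_ge0 ?exprn_ge0 ?invr_ge0.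
  - exact: dn.
  apply: is_cvg_geometric_series; rewrite ger0_norm ?invr_ge0//.
  by rewrite invf_lt1// ltr1n.
rewrite (_ : u_ ^~ x = fun n => series (fun n => u_ n.+1 x - u_ n x) n + u_ 0 x).
  by apply: is_cvgD => //; exact: is_cvg_cst.
by apply/funext => n; rewrite /series/= telescope_sumr// subrK.
Qed.

(** The upper limit is measurable and defined even where the sequence diverges, [fine] turning
    infinite values into 0. The last clause keeps limits zero at every point outside Omega, and not
    just almost everywhere. *)
Lemma fast_cauchy_limit : exists u : T -> R, [/\ measurable_fun setT u,
  {ae mu, forall x, u_ ^~ x @ \oo --> u x} &
  forall x, (forall n, u_ n x = 0) -> u x = 0].
Proof.
exists (fun x => fine (limn_esup (fun n => (u_ n x)%:E))); split.
- apply: (measurableT_comp (f := fine)) => //.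
  by apply: measurable_fun_limn_esup => n; apply/measurable_EFinP.
- apply: filterS fast_cauchy_ae_cvg => x cu.
  have cE : (u_ n x)%:E @[n --> \oo] --> (limn (u_ ^~ x))%:E.
    by apply: cvg_EFin; [exact: nearW|exact: cu].
  rewrite is_cvg_limn_esupE; last by apply/cvg_ex; eexists; exact: cE.
  by rewrite (cvg_lim _ cE).
- move=> x ux; under eq_fun do rewrite ux.
  have c0 : (fun=> 0%:E : \bar R) @ \oo --> (0%:E : \bar R) by exact: cvg_cst.
  rewrite is_cvg_limn_esupE; last by apply/cvg_ex; eexists; exact: c0.
  by rewrite (cvg_lim _ c0).
Qed.

End fast_cauchy.

(** * Weighted difference energies *)

(** With N the exceptional set, N x T and T x N are null, as 0 times infinity is 0. This transfers
    almost everywhere convergence of functions to their differences u(x) - u(y). *)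
Lemma ae_product d (T : measurableType d) (R : realType)
    (mu : {sigma_finite_measure set T -> \bar R}) (P : set T) :
  {ae mu, forall x, P x} -> {ae (mu \x mu)%E, forall z, P z.1 /\ P z.2}.
Proof.
move=> [N [mN N0 PN]]; exists ((N `*` setT) `|` (setT `*` N)); split.
- by apply: measurableU; exact: measurableX.
- have NT : ((mu \x mu) (N `*` setT) = 0)%E.
    by rewrite product_measure1E// [X in (X * _)%E](_ : _ = 0%E) ?mul0e.
  have TN : ((mu \x mu) (setT `*` N) = 0)%E.
    by rewrite product_measure1E// [X in (_ * X)%E](_ : _ = 0%E) ?mule0.
  apply/eqP; rewrite -measure_le0.
  apply: (@le_trans _ _ ((mu \x mu) (N `*` setT) + (mu \x mu) (setT `*` N))%E).
    by apply: measureU2; exact: measurableX.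
  by rewrite NT TN adde0.
- move=> z /= nP; apply: contrapT => /not_orP[n1 n2]; apply: nP; split.
    by apply: contrapT => n; apply: n1; split => //; exact: PN.
  by apply: contrapT => n; apply: n2; split => //; exact: PN.
Qed.

Section energy.
Context d (T : measurableType d) (R : realType)
  (mu : {sigma_finite_measure set T -> \bar R}) (kap : T * T -> R).
Hypothesis mkap : measurable_fun setT kap.
Implicit Types u v : T -> R.
Local Notation mu2 := (mu \x mu)%E.

Definition wdiff u (z : T * T) : R := (u z.1 - u z.2) * kap z.

Definition energy_space : set (T -> R) :=
  [set u | u \in Lfun mu 2%:E /\ wdiff u \in Lfun mu2 2%:E].

Lemma measurable_wdiff u : measurable_fun setT u -> measurable_fun setT (wdiff u).
Proof.
move=> mu_; apply: measurable_funM => //; apply: measurable_funB.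
  by apply: measurableT_comp => //; exact: measurable_fst.
by apply: measurableT_comp => //; exact: measurable_snd.
Qed.

Lemma wdiff_lin u v t :
  wdiff (fun x => u x + t * v x) = fun z => wdiff u z + t * wdiff v z.
Proof. by apply/funext => z; rewrite /wdiff; ring. Qed.

Lemma energy_lin u v t : energy_space u -> energy_space v ->
  energy_space (fun x => u x + t * v x).
Proof.
by move=> [Lu Du] [Lv Dv]; split; [|rewrite wdiff_lin]; exact: Lfun2_lin.
Qed.

Lemma energy0 : energy_space (fun=> 0).
Proof.
split; first by apply/Lfun2P; split => //; rewrite expr0n/= integral0 ltry.
apply/Lfun2P; split; first exact: measurable_wdiff.
under eq_integral do rewrite /wdiff subr0 mul0r expr0n/=.
by rewrite integral0 ltry.
Qed.

Lemma wdiff_ae_eq u v : {ae mu, forall x, u x = v x} ->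
  {ae mu2, forall z, wdiff u z = wdiff v z}.
Proof. by move=> /ae_product; apply: filterS => z; rewrite /wdiff => -[-> ->]. Qed.

Lemma energy_ae_eq u v : measurable_fun setT v ->
  {ae mu, forall x, u x = v x} -> energy_space u -> energy_space v.
Proof.
move=> mv uv [Lu Du]; split; first exact: Lfun2_ae_eq Lu uv.
by apply: Lfun2_ae_eq Du _; [exact: measurable_wdiff|exact: wdiff_ae_eq].
Qed.

(** For fixed n, Fatou's lemma is applied to u_(k+n) - u_n on T and to its weighted difference on T
    x T. The latter converges pointwise to the weighted difference of the limit, so no second limit
    has to be identified. *)
Lemma energy_complete (u_ : (T -> R)^nat) C :
  (forall n, energy_space (u_ n)) ->
  (forall n m, (n <= m)%N -> let w := fun x => u_ m x + -1 * u_ n x in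
    ip mu w w <= C * 16^-1 ^+ n /\ ip mu2 (wdiff w) (wdiff w) <= C * 16^-1 ^+ n) ->
  exists u, [/\ energy_space u,
    (forall n, let w := fun x => u x + -1 * u_ n x in
      ip mu w w <= C * 16^-1 ^+ n /\ ip mu2 (wdiff w) (wdiff w) <= C * 16^-1 ^+ n) &
    forall x, (forall n, u_ n x = 0) -> u x = 0].
Proof.
move=> Hu uC.
have mu_ n : measurable_fun setT (u_ n) by have [/Lfun2_measurable] := Hu n.
have Hd n m : energy_space (fun x => u_ m x + -1 * u_ n x) by exact: energy_lin.
have [|u [mu' ucvg u0]] := @fast_cauchy_limit _ _ _ mu u_ mu_ C.
  move=> n; have [+ _] := uC n n.+1 (leqnSn n).
  rewrite -lee_fin ip_sqrE; last by have [] := Hd n n.+1.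
  by under eq_integral do rewrite mulN1r.
have H n (w := fun x => u x + -1 * u_ n x) :
    (\int[mu]_x (w x ^+ 2)%:E <= (C * 16^-1 ^+ n)%:E)%E /\
    (\int[mu2]_x (wdiff w x ^+ 2)%:E <= (C * 16^-1 ^+ n)%:E)%E.
  have mw : measurable_fun setT w.
    by apply: measurable_funD => //; exact: measurable_funM.
  have wcvg x : u_ ^~ x @ \oo --> u x ->
      (fun k => u_ (k + n)%N x + -1 * u_ n x) @ \oo --> w x.
    rewrite -(cvg_shiftn n (u_ ^~ x)) => ux.
    by apply: cvgD; [exact: ux|exact: cvg_cst].
  split.
  - apply: (@fatou_sqr _ _ _ _ (fun k x => u_ (k + n)%N x + -1 * u_ n x)) => //.
    + by move=> k; apply: (Lfun2_measurable (mu := mu)); have [] := Hd n (k + n)%N.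
    + by apply: filterS ucvg => x; exact: wcvg.
    + move=> k; have [Hk _] := Hd n (k + n)%N.
      by rewrite -ip_sqrE// lee_fin; have [] := uC n (k + n)%N (leq_addl _ _).
  - apply: (@fatou_sqr _ _ _ _ (fun k => wdiff (fun x => u_ (k + n)%N x + -1 * u_ n x))) => //.
    + by move=> k; apply: (Lfun2_measurable (mu := mu2)); have [] := Hd n (k + n)%N.
    + exact: measurable_wdiff.
    + have := ae_product ucvg; apply: filterS => z [z1 z2].
      apply: cvgM; last exact: cvg_cst.
      by apply: cvgB; exact: wcvg.
    + move=> k; have [_ Hk] := Hd n (k + n)%N.
      by rewrite -ip_sqrE// lee_fin; have [] := uC n (k + n)%N (leq_addl _ _).
have E n : energy_space (fun x => u x + -1 * u_ n x).
  have [H1 H2] := H n; split; apply/Lfun2P; split.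
  - by apply: measurable_funD => //; exact: measurable_funM.
  - by rewrite (le_lt_trans H1)// ltry.
  - by apply: measurable_wdiff; apply: measurable_funD => //; exact: measurable_funM.
  - by rewrite (le_lt_trans H2)// ltry.
exists u; split => //.
- rewrite (_ : u = fun x => (u x + -1 * u_ 0 x) + 1 * u_ 0 x).
    exact: energy_lin.
  by apply/funext => x; ring.
- by move=> n w; have [E1 E2] := E n; have [H1 H2] := H n; split; rewrite -lee_fin ip_sqrE.
Qed.

End energy.

(** * Lebesgue measure and the boundary of a Lipschitz domain *)

Section rV_geometry.
Context {R : realType} {d : nat}.
Implicit Types (x y : 'rV[R]_d) (A U : set 'rV[R]_d).
Local Notation leb := (lebesgue_rV R d).

Lemma rV_normP x (M : R) : 0 <= M -> (`|x| <= M) <-> (forall i, `|x 0 i| <= M).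
Proof.
move=> M0; rewrite [`|x|]/Num.norm/= mx_normrE; split => [/bigmax_leP[_ xM] i|xM].
  by have /= := xM (0, i) isT.
by apply/bigmax_leP; split => // -[i j] _; rewrite ord1.
Qed.

Lemma rV_coord_le x i : `|x 0 i| <= `|x|.
Proof. by move: i; apply/rV_normP. Qed.

(** These sup-norm balls with rational centres form a countable base of the topology, enumerated by
    [pickle]. It links the topology to the sigma-algebra generated by the coordinates. *)
Definition rat_ball (q : 'rV[rat]_d) (n : nat) : set 'rV[R]_d :=
  [set x | forall i, `|x 0 i - ratr (q 0 i)| < n.+1%:R^-1].

Lemma measurable_rat_ball q n : measurable (rat_ball q n).
Proof.
rewrite (_ : rat_ball q n = \bigcap_(i in [set: 'I_d])
    (rV_coord i @^-1` [set t : R | `|t - ratr (q 0 i)| < n.+1%:R^-1])).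
  apply: fin_bigcap_measurable => [|i _]; first exact: finite_finset.
  rewrite -[X in measurable X]setTI; apply: measurable_rV_coord => //.
  rewrite (_ : mkset _ = `](ratr (q 0 i) - n.+1%:R^-1), (ratr (q 0 i) + n.+1%:R^-1)[%classic)//.
  by apply/seteqP; split => t /=; rewrite in_itv/= ltr_distl.
by apply/seteqP; split => [x xA i _|x xA i]; exact: xA.
Qed.

Lemma rat_ball_nbhs x U : nbhs x U ->
  exists q n, rat_ball q n x /\ rat_ball q n `<=` U.
Proof.
move=> /nbhs_ballP[e /= e0 xU].
have [n ne] : exists n, n.+1%:R^-1 < e / 2.
  have e2 : 0 < e / 2 by rewrite divr_gt0.
  by have [n _ /(_ n (leqnn n))] := near_infty_natSinv_lt (PosNum e2); exists n.
have n0 : 0 < n.+1%:R^-1 :> R by rewrite invr_gt0.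
have /choice[q qP] : forall i, exists q : rat, `|x 0 i - ratr q| < n.+1%:R^-1.
  move=> i; have xn : x 0 i < x 0 i + n.+1%:R^-1 by rewrite ltrDl.
  have [q] := rat_in_itvoo xn; rewrite in_itv/= => /andP[q1 q2]; exists q.
  by rewrite distrC ltr_distl q2 (lt_trans _ q1)// gtrBl.
exists (\row_i q i), n; split; first by move=> i; rewrite mxE.
move=> y yq; apply: xU; rewrite mx_norm_ball /ball_/=.
apply: (@le_lt_trans _ _ (n.+1%:R^-1 + n.+1%:R^-1)); last by rewrite [ltRHS]splitr ltrD.
apply/rV_normP; first by rewrite addr_ge0 ?ltW.
move=> i; rewrite !mxE (_ : _ - _ = (x 0 i - ratr (q i)) - (y 0 i - ratr (q i))); last by ring.
rewrite (le_trans (ler_normB _ _))// lerD ?ltW//.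
by have := yq i; rewrite mxE.
Qed.

Lemma open_measurable_rV U : open U -> measurable U.
Proof.
move=> oU.
pose V (k : nat) : set 'rV[R]_d := if unpickle k is Some p then
  if `[<rat_ball p.1 p.2 `<=` U>] then rat_ball p.1 p.2 else set0 else set0.
rewrite (_ : U = \bigcup_k V k).
  apply: bigcupT_measurable => k; rewrite /V.
  case: unpickle => [[q n]|]//=; case: ifPn => // _; exact: measurable_rat_ball.
apply/seteqP; split => [x Ux|x [k _]]; last first.
  by rewrite /V; case: unpickle => // p; case: asboolP => // pU; exact: pU.
have [q [n [qx qU]]] := rat_ball_nbhs (open_nbhs_nbhs (conj oU Ux)).
exists (pickle (q, n)) => //; rewrite /V pickleK/=.
by case: asboolP.
Qed.

(** A Lindelöf argument: the rational balls with negligible trace on [A] cover [A], and there are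
    countably many of them. *)
Lemma negligible_locally A :
  (forall x, A x -> exists2 U, nbhs x U & leb.-negligible (A `&` U)) ->
  leb.-negligible A.
Proof.
move=> loc.
pose V (k : nat) : set 'rV[R]_d := if unpickle k is Some p then
  if `[<leb.-negligible (A `&` rat_ball p.1 p.2)>] then A `&` rat_ball p.1 p.2
  else set0 else set0.
apply: (@negligibleS _ _ _ _ (\bigcup_k V k)); last first.
  apply: negligible_bigcup => k; rewrite /V.
  case: unpickle => [p|]; last exact: negligible_set0.
  by case: asboolP => // _; exact: negligible_set0.
move=> x Ax; have [U xU nU] := loc x Ax.
have [q [n [qx qU]]] := rat_ball_nbhs xU.
exists (pickle (q, n)) => //; rewrite /V pickleK/=.
case: asboolP => // nn; exfalso; apply: nn.
by apply: negligibleS nU; apply: setIS.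
Qed.

Lemma measurable_translation y : measurable_fun setT (fun x : 'rV[R]_d => x + y).
Proof.
apply: measurable_fun_rVP => i.
rewrite (_ : _ \o _ = fun x => rV_coord i x + y 0 i).
  by apply: measurable_funD => //; exact: measurable_rV_coord.
by apply/funext => x; rewrite /rV_coord/= mxE.
Qed.

End rV_geometry.

Lemma lebesgue_measure_translation (R : realType) (v : R) (A : set R) : measurable A ->
  @lebesgue_measure R ((fun t => t + v) @^-1` A) = @lebesgue_measure R A.
Proof.
move=> mA.
have mv : measurable_fun setT ((fun t => t + v) : measurableTypeR R -> measurableTypeR R).
  exact: measurable_funD.
have H := @lebesgue_measure_unique R (pushforward (@lebesgue_measure R)
  ((fun t => t + v) : measurableTypeR R -> measurableTypeR R)).
apply/esym/(H mv) => // _ [[a b]] _ <-; rewrite /pushforward.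
rewrite [X in _ = lebesgue_measure X](_ : _ = `](a - v), (b - v)]%classic); last first.
  by apply/seteqP; split => t/=; rewrite !in_itv/= ltrBlDr lerBrDr.
rewrite !lebesgue_measure_itv/= !lte_fin ltrD2r; case: ifPn => // _.
by congr (_%:E); ring.
Qed.

(** By induction on the dimension: through [rV_cons] the translation becomes the product [tau] of
    two translations, and a product measure is determined by its values on rectangles. *)
Lemma lebesgue_rV_translation (R : realType) (d : nat) (v : 'rV[R]_d)
    (A : set 'rV[R]_d) : measurable A ->
  lebesgue_rV R d ((fun x => x + v) @^-1` A) = lebesgue_rV R d A.
Proof.
elim: d v A => [|n IH] v A mA.
  congr (lebesgue_rV _ _ _); apply/seteqP; split => x /=;
    by rewrite (_ : x + v = x)//; apply/rowP => -[].
pose w : 'rV[R]_n := rsubmx (v : 'rV[R]_(1 + n)).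
pose tau (p : measurableTypeR R * 'rV[R]_n) : measurableTypeR R * 'rV[R]_n :=
  (p.1 + v 0 ord0, p.2 + w).
have mtau : measurable_fun setT tau.
  apply/measurable_fun_pairP; split.
    by apply: measurable_funD => //; exact: measurable_fst.
  by apply: (measurableT_comp (measurable_translation w)); exact: measurable_snd.
rewrite /= /lebesgue_cons /pushforward.
have E p : rV_cons p + v = rV_cons (tau p).
  rewrite /rV_cons/= -[in LHS](@hsubmxK _ 1 1 n v) [LHS](@add_row_mx _ 1 1 n).
  congr (@row_mx R 1 1 n _ _); apply/matrixP => i j; rewrite !mxE !ord1; congr (_ + v _ _).
  exact/val_inj.
have -> : @rV_cons R n @^-1` ((fun x => x + v) @^-1` A) =
    tau @^-1` (@rV_cons R n @^-1` A).
  by apply/seteqP; split => p; rewrite /preimage /mkset E.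
have mB : measurable (@rV_cons R n @^-1` A).
  by rewrite -[X in measurable X]setTI; exact: (@measurable_rV_cons R n).
have mpre (B : set (measurableTypeR R * 'rV[R]_n)) : measurable B -> measurable (tau @^-1` B).
  by move=> mB'; rewrite -[X in measurable X]setTI; exact: mtau.
have H := @product_measure_unique _ _ _ _ _ (@lebesgue_measure R) (lebesgue_rV R n)
  (pushforward (@lebesgue_measure R \x lebesgue_rV R n)%E tau).
apply/esym/(H mtau) => // B C mB' mC; rewrite /pushforward.
transitivity ((@lebesgue_measure R \x lebesgue_rV R n)%E
    (((fun t => t + v 0 ord0) @^-1` B) `*` ((fun x => x + w) @^-1` C))) => //.
rewrite product_measure1E.
- by congr (_ * _)%E; [exact: lebesgue_measure_translation|exact: IH].
- rewrite -[X in measurable X]setTI; exact: measurable_funD.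
- by rewrite -[X in measurable X]setTI; exact: measurable_translation.
Qed.

(** * Nullity of Lipschitz boundaries *)

Section boundary_null.
Context {R : realType} {d : nat}.
Implicit Types (x y e : 'rV[R]_d) (A G U : set 'rV[R]_d).
Local Notation leb := (lebesgue_rV R d).

Lemma lebesgue_rV_cube (M : R) : 0 <= M ->
  (leb [set x : 'rV[R]_d | forall i, (x 0 i \in `[- M, M])%R] < +oo)%E.
Proof.
move=> M0; rewrite (@lebesgue_rV_box R d (fun=> `[- M, M]%classic))//.
rewrite (eq_bigr (fun=> (M + M)%:E)); last first.
  move=> i _; rewrite lebesgue_measure_itv/= lte_fin; case: ltP.
    by move=> _; rewrite opprK.
  by move=> MN; rewrite (_ : M = 0) ?addr0//; lra.
rewrite ltey_eq; apply/orP; left.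
by elim/big_ind : _ => // x y; exact: fin_numM.
Qed.

Lemma lebesgue_rV_norm_le (M : R) G : measurable G -> (forall x, G x -> `|x| <= M) ->
  (leb G < +oo)%E.
Proof.
move=> mG GM; have [->|/set0P[x0 Gx0]] := eqVneq G set0; first by rewrite measure0.
have M0 : 0 <= M by apply: le_trans (GM _ Gx0).
apply: le_lt_trans (lebesgue_rV_cube M0); apply: le_measure; rewrite ?inE//.
  rewrite (_ : mkset _ = \bigcap_(i in [set: 'I_d]) (rV_coord i @^-1` `[- M, M]%classic)).
    apply: fin_bigcap_measurable => [|i _]; first exact: finite_finset.
    by rewrite -[X in measurable X]setTI; exact: measurable_rV_coord.
  by apply/seteqP; split => [x xA i _|x xA i]; exact: xA.
move=> x /GM xM i; rewrite in_itv/= -ler_norml.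
by move: i; apply/rV_normP.
Qed.

(* The translates of [G] by the multiples of [e] are pairwise disjoint and have
   the same measure, and infinitely many of them lie in a bounded set. *)
Lemma lebesgue_rV_transversal G e (M : R) : measurable G ->
  (forall x, G x -> `|x| <= M) ->
  (forall x (t : R), G x -> G (x + t *: e) -> t = 0) ->
  leb G = 0%E.
Proof.
move=> mG GM Ge.
(* The shifts 1/(n+1) are distinct and at most 1, so all translates stay in the ball of radius M +
   |e|. *)
pose F (n : nat) : set 'rV[R]_d := (fun x => x + n.+1%:R^-1 *: e) @^-1` G.
have mF n : measurable (F n).
  by rewrite -[X in measurable X]setTI; exact: measurable_translation.
have FG n : leb (F n) = leb G by exact: lebesgue_rV_translation.
have tF : trivIset setT F.
  apply/trivIsetP => i j _ _ ij; apply/seteqP; split => // x [Fi Fj]; exfalso.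
  move: ij => /negP; apply.
  have := Ge (x + i.+1%:R^-1 *: e) (j.+1%:R^-1 - i.+1%:R^-1) Fi.
  rewrite -addrA -scalerDl (addrC i.+1%:R^-1) subrK => /(_ Fj)/eqP.
  by rewrite subr_eq0 => /eqP/invr_inj/eqP; rewrite eqr_nat eqSS eq_sym.
have mU : measurable (\bigcup_n F n) by exact: bigcupT_measurable.
have Uoo : (leb (\bigcup_n F n) < +oo)%E.
  apply: (@lebesgue_rV_norm_le (M + `|e|)) => // x [n _ /GM xn].
  rewrite (_ : x = (x + n.+1%:R^-1 *: e) - n.+1%:R^-1 *: e); last by rewrite addrK.
  apply: (le_trans (ler_normB _ _)); rewrite lerD// normrZ ger0_norm ?invr_ge0//.
  by rewrite ler_piMl// invf_le1// ler1n.
have sumF n : (\sum_(0 <= i < n) leb (F i) <= leb (\bigcup_n F n))%E.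
  rewrite measure_bigcup//.
  apply: (@le_trans _ _ (\sum_(i <oo) leb (F i))%E); last first.
    by rewrite le_eqVlt; apply/orP; left; apply/eqP/eq_eseriesl => i; rewrite in_setT.
  by apply: nneseries_lim_ge => k _ _; exact: measure_ge0.
have Gfin : leb G \is a fin_num.
  by rewrite ge0_fin_numE// (lebesgue_rV_norm_le mG GM).
have Ufin : leb (\bigcup_n F n) \is a fin_num by rewrite ge0_fin_numE.
set c := fine (leb G); set K := fine (leb (\bigcup_n F n)).
have c0 : 0 <= c by exact: fine_ge0.
have cK n : n%:R * c <= K.
  rewrite -lee_fin /K fineK//; apply: le_trans (sumF n).
  under eq_bigr do rewrite FG -(fineK Gfin).
  by rewrite sumEFin sumr_const_nat subn0 mulr_natl.
rewrite -(fineK Gfin) -/c; congr (_%:E); apply/eqP; rewrite eq_le c0 andbT leNgt.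
apply/negP => cp.
have := cK (Num.bound (K / c)).
rewrite leNgt => /negP; apply; rewrite -ltr_pdivrMr//.
have K0 : 0 <= K by exact: fine_ge0.
by have := archi_boundP (divr_ge0 K0 c0).
Qed.

Lemma rV_mulmx_bounded n (O : 'M[R]_(d, n)) : exists2 S : R, 0 <= S &
  forall x, `|x *m O| <= S * `|x|.
Proof.
exists (\sum_j \sum_i `|O j i|); first by apply: sumr_ge0 => j _; exact: sumr_ge0.
move=> x; apply/rV_normP.
  by rewrite mulr_ge0// sumr_ge0// => j _; exact: sumr_ge0.
move=> i; rewrite mxE (le_trans (ler_norm_sum _ _ _))// mulr_suml ler_sum// => j _.
rewrite normrM mulrC ler_pM//; last exact: rV_coord_le.
by rewrite (bigD1 i)//= lerDl sumr_ge0.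
Qed.

(* In a local chart, the boundary is the zero set of this function. *)
Lemma continuous_chart (O : 'M[R]_d) (i : 'I_d) (g : 'rV[R]_d.-1 -> R^o) :
  lipschitz g -> continuous (fun x : 'rV[R]_d => (x *m O) 0 i - g (col' i (x *m O)) : R).
Proof.
move=> /pinfty_ex_gt0[k k0 gk].
have [S S0 OS] := rV_mulmx_bounded O.
have H x y : `|((x *m O) 0 i - g (col' i (x *m O))) - ((y *m O) 0 i - g (col' i (y *m O)))|
    <= (S + k * S + 1) * `|x - y|.
  have E : (x *m O) 0 i - (y *m O) 0 i = ((x - y) *m O) 0 i by rewrite mulmxBl !mxE.
  have n1 : `|(x *m O) 0 i - (y *m O) 0 i| <= S * `|x - y|.
    by rewrite E (le_trans (rV_coord_le _ _)).
  have n2 : `|g (col' i (x *m O)) - g (col' i (y *m O))| <= k * (S * `|x - y|).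
    have /= := gk (col' i (x *m O), col' i (y *m O)) (conj I I).
    move=> /le_trans; apply; rewrite ler_pM2l//.
    have C : col' i (x *m O) - col' i (y *m O) = col' i ((x - y) *m O).
      by apply/rowP => j; rewrite mulmxBl !mxE.
    have : `|col' i ((x - y) *m O)| <= S * `|x - y|.
      apply: le_trans (OS _); apply/rV_normP => // j.
      by rewrite mxE rV_coord_le.
    by rewrite -C.
  rewrite (_ : _ - _ = ((x *m O) 0 i - (y *m O) 0 i) -
    (g (col' i (x *m O)) - g (col' i (y *m O)))); last by ring.
  apply: (le_trans (ler_normB _ _)); have := normr_ge0 (x - y).
  by move: n1 n2; set a := `|_|; set b := `|_ : R|; set c := `|_ : 'rV[R]_d|; nra.
move=> x; apply/(@cvgrPdist_lt _ _ _ (nbhs x) (nbhs_filter x)) => e e0.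
have S1 : 0 < S + k * S + 1 by rewrite ltr_pwDr// addr_ge0// mulr_ge0// ltW.
apply/nbhs_ballP; exists (e / (S + k * S + 1)); first by rewrite /= divr_gt0.
move=> y; rewrite mx_norm_ball /ball_/= => xy.
by rewrite (le_lt_trans (H _ _))// mulrC -ltr_pdivlMr.
Qed.

(** Near a boundary point, the boundary lies on the zero set of [h], the height above the Lipschitz
    graph. Along the vertical axis [h] grows at unit rate, so each vertical line meets the graph
    once and [lebesgue_rV_transversal] applies. *)
Lemma boundary_negligible (Omega : set 'rV[R]_d) :
  lipschitz_boundary Omega -> leb.-negligible (boundary Omega).
Proof.
move=> lipO; apply: negligible_locally => x0 bx0.
have [Q [i [g [orthQ lg W]]]] := lipO x0 bx0.
pose h (x : 'rV[R]_d) : R := (x *m Q) 0 i - g (col' i (x *m Q)).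
have ch : continuous h by exact: continuous_chart.
pose B : set 'rV[R]_d := ball x0 1.
pose G := [set x | h x = 0] `&` B.
have oB : open B by exact: ball_open.
have nB : nbhs x0 B by exact: nbhsx_ballx.
have op (P : set R) : open P -> open (h @^-1` P) by move=> oP; apply: open_comp => // x _.
have mG : measurable G.
  apply: measurableI; last exact: open_measurable_rV.
  rewrite (_ : mkset _ = ~` (h @^-1` [set t | t > 0]) `&` ~` (h @^-1` [set t | t < 0])).
    by apply: measurableI; apply: measurableC; apply: open_measurable_rV; apply: op;
      [exact: open_gt|exact: open_lt].
  by apply/seteqP; split => x /=; [move=> ->; rewrite ltxx|move=> [? ?]; lra].
have G0 : leb G = 0%E.
  (* The vertical axis in the original coordinates: multiplied by [Q], it becomes the i-th unit
     vector. The unit ball [B] makes [G] bounded. *)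
  apply: (@lebesgue_rV_transversal G (delta_mx 0 i *m Q^T) (`|x0| + 1)) => //.
    move=> x [_]; rewrite /B mx_norm_ball /ball_/= distrC => /ltW xx.
    by rewrite -[x](subrK x0) (le_trans (ler_normD _ _))// addrC lerD2l.
  move=> x t [hx _] [hxt _]; move: hxt hx; rewrite /h/= mulmxDl -scalemxAl -mulmxA.
  have -> : Q^T *m Q = 1%:M by exact: mulmx1C.
  rewrite mulmx1.
  rewrite (_ : col' i (_ + _) = col' i (x *m Q)); last first.
    apply/rowP => j; rewrite !mxE (_ : (lift i j == i) = false) ?andbF ?mulr0 ?addr0//.
    by rewrite eq_sym (negbTE (neq_lift _ _)).
  have -> : (x *m Q + t *: delta_mx 0 i) 0 i = (x *m Q) 0 i + t.
    by rewrite mxE; congr (_ + _); rewrite !mxE !eqxx mulr1.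
  by move=> p1 p2; lra.
pose N : set 'rV[R]_d := [set x | Omega x <-> g (col' i (x *m Q)) < (x *m Q) 0 i].
exists (N° `&` B); first by apply: filterI => //; apply: nbhs_interior.
apply: (@negligibleS _ _ _ _ G); last by apply/negligibleP.
(* If [h x] is nonzero, its sign is constant near [x], which then lies in the interior of Omega or
   outside its closure. *)
move=> x [[clx nix] [Nx Bx]]; split => //=.
have NE y : N y -> (Omega y <-> 0 < h y) by rewrite /N/= /h subr_gt0.
have [hx|hx|//] := ltgtP (h x) 0; exfalso.
- have xn : nbhs x (h @^-1` [set t | t < 0]).
    by apply: open_nbhs_nbhs; split => //; apply: op; exact: open_lt.
  have [y [Oy [Ny hy]]] := clx _ (filterI Nx xn).
  by have [/(_ Oy) + _] := NE y Ny; rewrite ltNge (ltW hy).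
- have xn : nbhs x (h @^-1` [set t | t > 0]).
    by apply: open_nbhs_nbhs; split => //; apply: op; exact: open_gt.
  apply: nix; apply: filterS (filterI Nx xn) => y [Ny hy].
  by have [_] := NE y Ny; apply.
Qed.

End boundary_null.

(** * Positivity of the normalization constant *)

Section gamma_gt0.
Context {R : realType}.
Local Notation leb := (@lebesgue_measure R).

Lemma integral_powR_itv01 (z : R) : 0 < z ->
  (\int[leb]_(t in `]0%R, 1%R]) (z * t `^ (z - 1))%R%:E <= 1)%E.
Proof.
move=> z0; pose f (t : R) := z * t `^ (z - 1).
have mf : measurable_fun setT f.
  by apply: measurable_funM => //; exact: measurable_powR.
have f0 t : 0 <= f t by rewrite mulr_ge0 ?powR_ge0// ltW.
(* Away from 0 the primitive t^z is available by the fundamental theorem of calculus; n + 2 keeps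
   the left end below 1. *)
pose F (n : nat) : set (measurableTypeR R) := `[n.+2%:R^-1, 1]%classic.
have FE : \bigcup_n F n = `]0, 1]%classic.
  apply/seteqP; split => [t [n _]|t]; rewrite /F/= !in_itv/= => /andP[nt t1].
    by rewrite t1 andbT (lt_le_trans _ nt).
  have [n _ /(_ n.+1) nP] := near_infty_natSinv_lt (PosNum nt).
  by exists n => //=; rewrite in_itv/= t1 andbT ltW// nP/=.
have ndF : nondecreasing_seq F.
  move=> n m nm; apply/subsetPset => t; rewrite /F/= !in_itv/= => /andP[nt ->].
  by rewrite andbT (le_trans _ nt)// lef_pV2 ?posrE// ler_nat !ltnS.
have mFf n : measurable_fun (F n) (EFin \o f).
  by apply/measurable_EFinP; exact: measurable_funTS.
have cvgF := @ge0_nondecreasing_set_cvg_integral _ (measurableTypeR R) _ F (EFin \o f) leb ndF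
  (fun n => measurable_itv _) mFf (fun _ _ _ => f0 _).
rewrite -FE; apply: (cvge_le _ cvgF); apply: nearW => n.
have e0 : 0 < n.+2%:R^-1 :> R by rewrite invr_gt0.
have e1 : n.+2%:R^-1 < 1 :> R by rewrite invf_lt1// ltr1n.
have cp (p t : R) : 0 < t -> {for t, continuous (@powR R ^~ p)}.
  move=> t0; apply/differentiable_continuous/derivable1_diffP/derivable_powR.
  by rewrite in_itv/= t0.
rewrite (@continuous_FTC2 _ f (@powR R ^~ z))//.
- by rewrite powR1 -EFinB lee_fin gerBl powR_ge0.
- apply: continuous_in_subspaceT => t; rewrite inE/= in_itv/= => /andP[nt _].
  apply: cvgM; first exact: cvg_cst.
  by apply: cp; exact: lt_le_trans nt.
- split.
  + move=> t; rewrite in_itv/= => /andP[nt _]; apply: derivable_powR.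
    by rewrite in_itv/= (lt_trans _ nt).
  + by apply: cvg_at_right_filter; exact: cp.
  + by apply: cvg_at_left_filter; exact: cp.
- move=> t; rewrite in_itv/= => /andP[nt _]; rewrite powR_derive1//.
  by rewrite in_itv/= (lt_trans _ nt).
Qed.

(** The inequality ln y < y at y = t / (2 z) is multiplied by z; t >= 1 allows the exponent z - 1 to
    be raised to z first. *)
Lemma powR_le_expR (z t : R) : 0 < z -> 1 <= t ->
  t `^ (z - 1) <= expR (z * ln (2 * z)) * expR (t / 2).
Proof.
move=> z0 t1; have t0 : 0 < t by exact: lt_le_trans t1.
apply: (@le_trans _ _ (t `^ z)); first by rewrite ler_powR// gerBl.
rewrite /powR gt_eqF// -expRD ler_expR.
have z2 : 0 < 2 * z by rewrite mulr_gt0.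
have -> : ln t = ln (t / (2 * z)) + ln (2 * z).
  by rewrite -lnM ?posrE ?divr_gt0// divfK// gt_eqF.
rewrite mulrDr addrC lerD2l.
have -> : t / 2 = z * (t / (2 * z)) by field; rewrite gt_eqF.
by rewrite ler_pM2l// ltW// ln_sublinear// divr_gt0.
Qed.

(** Most of the work is finiteness, without which [fine] would return 0: near 0 the integrand is
    below t^(z-1), beyond 1 it is below a multiple of an exponential density. If the integral
    vanished, the positive integrand would be zero almost everywhere on a half-line of infinite
    measure. *)
Lemma Gamma_gt0 (z : R) : 0 < z -> 0 < Gamma z.
Proof.
move=> z0; pose f (t : R) := t `^ (z - 1) * expR (- t).
have mf : measurable_fun setT f.
  apply: measurable_funM; first exact: measurable_powR.
  by apply: measurableT_comp => //; exact: measurable_expR.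
have f0 t : 0 <= f t by rewrite mulr_ge0 ?powR_ge0 ?expR_ge0.
have mEf (D : set R) : measurable_fun D (EFin \o f).
  by apply/measurable_EFinP; exact: measurable_funTS.
have mz : measurable_fun setT (fun t : R => z * t `^ (z - 1)).
  by apply: measurable_funM => //; exact: measurable_powR.
have I1 : (\int[leb]_(t in `]0%R, 1%R]) (f t)%:E < +oo)%E.
  apply: (@le_lt_trans _ _ (z^-1%:E * \int[leb]_(t in `]0%R, 1%R]) (z * t `^ (z - 1))%R%:E)%E).
    rewrite -ge0_integralZl//; last 3 first.
    - by apply/measurable_EFinP; exact: measurable_funTS.
    - by move=> t _; rewrite lee_fin mulr_ge0 ?powR_ge0// ltW.
    - by rewrite lee_fin invr_ge0 ltW.
    apply: ge0_le_integral => //.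
    - by move=> t _; rewrite lee_fin.
    - exact: mEf.
    - apply: measurable_funeM; apply/measurable_EFinP; exact: measurable_funTS.
    - move=> t; rewrite /= in_itv/= => /andP[t0 _].
      rewrite -EFinM lee_fin mulrA mulVf ?gt_eqF// mul1r ler_piMr ?powR_ge0//.
      by rewrite -expR0 ler_expR oppr_le0 ltW.
  apply: (@le_lt_trans _ _ (z^-1%:E * 1)%E); last by rewrite mule1 ltry.
  by rewrite lee_wpmul2l ?integral_powR_itv01// lee_fin invr_ge0 ltW.
have h0 : 0 < 2^-1 :> R by rewrite invr_gt0.
have I2 : (\int[leb]_(t in `]1%R, +oo[) (f t)%:E < +oo)%E.
  (* The density of rate 1/2 is e^(-t/2) / 2; the factor 2 cancels its normalization. *)
  pose C := expR (z * ln (2 * z)) * 2.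
  have C0 : 0 <= C by rewrite mulr_ge0 ?expR_ge0.
  pose e := exponential_pdf (2^-1 : R).
  have e0 t : 0 <= e t by apply: exponential_pdf_ge0; exact: ltW.
  have me : measurable_fun setT e by exact: measurable_exponential_pdf.
  apply: (@le_lt_trans _ _ (C%:E * \int[leb]_t (e t)%:E)%E); last first.
    by rewrite integral_exponential_pdf// mule1 ltry.
  rewrite -ge0_integralZl//; last 2 first.
  - exact/measurable_EFinP.
  - by move=> t _; rewrite lee_fin.
  apply: (@le_trans _ _ (\int[leb]_(t in `]1%R, +oo[) (C%:E * (e t)%:E))%E).
    apply: ge0_le_integral => //.
    - by move=> t _; rewrite lee_fin.
    - exact: mEf.
    - apply: measurable_funeM; apply/measurable_EFinP; exact: measurable_funTS.
    - move=> t; rewrite /= in_itv/= andbT => t1.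
      have t0 : 0 <= t by rewrite (le_trans ler01)// ltW.
      rewrite -EFinM lee_fin /e exponential_pdfE// /f /C.
      rewrite mulrA -(mulrA (expR _)) mulfV// mulr1.
      rewrite (_ : - t = - (t / 2) + (- 2^-1 * t)); last by lra.
      rewrite expRD mulrA ler_wpM2r ?expR_ge0//.
      by rewrite expRN ler_pdivrMr ?expR_gt0// powR_le_expR// ltW.
  apply: ge0_subset_integral => //.
  - by apply: measurable_funeM; exact/measurable_EFinP.
  - by move=> t _; rewrite lee_fin mulr_ge0.
have E : `]0, +oo[%classic = `]0, 1]%classic `|` `]1, +oo[%classic :> set R.
  by rewrite -itv_bndbnd_setU// bnd_simp.
have Ioo : (\int[leb]_(t in `]0%R, +oo[) (f t)%:E < +oo)%E.
  rewrite E ge0_integral_setU//.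
  - by rewrite lte_add_pinfty.
  - exact: mEf.
  - by move=> t _; rewrite lee_fin.
  - apply/disj_setPS => t [] /=; rewrite !in_itv/= => /andP[_ t1] /andP[].
    by rewrite ltNge t1.
apply: fine_gt0; apply/andP; split; last exact: Ioo.
rewrite lt_neqAle; apply/andP; split; last first.
  by apply: integral_ge0 => t _; rewrite lee_fin f0.
apply/eqP => /esym I0.
have : (\int[leb]_(t in `]0%R, +oo[) `|(f t)%:E| = 0)%E.
  by rewrite -[RHS]I0; apply: eq_integral => t _; rewrite gee0_abs// lee_fin.
have mD : measurable (`]0, +oo[%classic : set R) by [].
have [abs0 _] := ae_eq_integral_abs leb mD (mEf _).
move=> /abs0[N [mN N0 DN]].
have := @le_measure _ _ _ leb `]0, +oo[%classic N.
rewrite !inE => /(_ mD mN).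
have : `]0, +oo[%classic `<=` N.
  move=> t t0; apply: DN => /= /(_ t0) [] /eqP.
  move: t0; rewrite /= in_itv/= andbT => t0.
  by rewrite gt_eqF// mulr_gt0 ?powR_gt0 ?expR_gt0.
move=> /[swap] /[apply].
move=> le; have : (leb `]0%R, +oo[%classic <= 0)%E.
  by apply: le_trans le _; rewrite le_eqVlt; apply/orP; left; apply/eqP; exact: N0.
by rewrite lebesgue_measure_itv/= ltry.
Qed.

Lemma fracC_gt0 (d : nat) (s : R) : 0 < s < 1 -> 0 < @fracC R d s.
Proof.
move=> /andP[s0 s1].
have G1 : 0 < Gamma (s + d%:R / 2) by apply: Gamma_gt0; rewrite ltr_pwDl// divr_ge0.
have G2 : 0 < Gamma (1 - s) by apply: Gamma_gt0; rewrite subr_gt0.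
have P1 : 0 < 2 `^ (2 * s) by exact: powR_gt0.
have P2 : 0 < pi `^ (d%:R / 2) :> R by apply: powR_gt0; exact: pi_gt0.
by rewrite /fracC divr_gt0// !mulr_gt0.
Qed.

End gamma_gt0.

(** * Weak solutions and the adjoint state *)

Lemma patch_idE (T : Type) (R : realType) (u : T -> R) (Om : set T) :
  u \_ Om = u <-> forall x, ~ Om x -> u x = 0.
Proof.
split => [<- x Ox|u0]; first by rewrite patchE memNset.
apply/funext => x; rewrite patchE; case: ifPn => //.
by rewrite notin_setE => /u0.
Qed.

Section weak_solutions.
Context d (T : measurableType d) (R : realType)
  (mu : {sigma_finite_measure set T -> \bar R}) (kap : T * T -> R).
Hypothesis mkap : measurable_fun setT kap.
Variables (Om : set T) (c a b : R).
Hypotheses (c_gt0 : 0 < c) (a_gt0 : 0 < a).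
Implicit Types Q h u v w p : T -> R.
Local Notation mu2 := (mu \x mu)%E.
Local Notation wd := (wdiff kap).

Definition energy_on : set (T -> R) :=
  [set u | energy_space mu kap u /\ u \_ Om = u].
Local Notation H := energy_on.

(** The bounds hold on all of [T], so that [form] is bounded and coercive with no reference to [Om];
    values off [Om] are harmless because members of [energy_on] vanish there. *)
Definition coefficient (Q : T -> R) :=
  measurable_fun setT Q /\ forall x, a <= Q x <= b.

Definition form Q u v : R :=
  c * ip mu2 (wd u) (wd v) + ip mu (fun x => Q x * u x) v.

Lemma energy_on_lin u v t : H u -> H v -> H (fun x => u x + t * v x).
Proof.
move=> [Eu /patch_idE u0] [Ev /patch_idE v0]; split; first exact: energy_lin.
by apply/patch_idE => x Ox; rewrite u0// v0// mulr0 addr0.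
Qed.

Lemma energy_on0 : H (fun=> 0).
Proof. by split; [exact: energy0|apply/patch_idE]. Qed.

Lemma Lfun2_coef Q u (M : R) : measurable_fun setT Q -> (forall x, `|Q x| <= M) ->
  u \in Lfun mu 2%:E -> (fun x => Q x * u x) \in Lfun mu 2%:E.
Proof.
move=> mQ QM Lu; apply: (@Lfun2_dom _ _ _ _ _ u M) => //.
  by apply: measurable_funM => //; exact: Lfun2_measurable Lu.
by apply: aeW => x; rewrite normrM ler_wpM2r.
Qed.

Lemma coefficient_norm Q x : coefficient Q -> `|Q x| <= b.
Proof.
move=> [_ /(_ x)/andP[aQ Qb]]; rewrite ger0_norm//.
by rewrite (le_trans _ aQ)// ltW.
Qed.

Lemma coefM Q u : coefficient Q -> u \in Lfun mu 2%:E ->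
  (fun x => Q x * u x) \in Lfun mu 2%:E.
Proof.
by move=> cQ; apply: (@Lfun2_coef _ _ b); [case: cQ|move=> x; exact: coefficient_norm].
Qed.

Lemma ip_mulC (h u v : T -> R) : ip mu (fun x => h x * u x) v = ip mu (fun x => h x * v x) u.
Proof. by apply: eq_Rintegral => x _; rewrite mulrAC. Qed.

Lemma formC Q u v : form Q u v = form Q v u.
Proof. by rewrite /form ipC ip_mulC. Qed.

Lemma form_linl Q u v w t : coefficient Q -> H u -> H v -> H w ->
  form Q (fun x => u x + t * v x) w = form Q u w + t * form Q v w.
Proof.
move=> cQ [[Lu Du] _] [[Lv Dv] _] [[Lw Dw] _].
rewrite /form wdiff_lin ip_linl// (_ : (fun x => Q x * _) =
  fun x => Q x * u x + t * (Q x * v x)); last by apply/funext => x; ring.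
rewrite ip_linl ?coefM//; ring.
Qed.

Lemma form_bounds Q u : coefficient Q -> H u ->
  c * ip mu2 (wd u) (wd u) + a * ip mu u u <= form Q u u
    <= c * ip mu2 (wd u) (wd u) + b * ip mu u u.
Proof.
move=> cQ [[Lu Du] _]; rewrite /form !lerD2l.
have iu := ip_integrable Lu Lu; have iQ := ip_integrable (coefM cQ Lu) Lu.
have iZ k : mu.-integrable setT (EFin \o (fun x => k * (u x * u x))).
  by apply/(@integrableZl _ _ _ _ _ measurableT _ (EFin \o (fun x => u x * u x))).
rewrite /ip -!RintegralZl//.
apply/andP; split; apply: le_Rintegral => // x _; rewrite -mulrA;
  by rewrite ler_wpM2r ?[u x * u x]mulr_ge0 -?expr2 ?sqr_ge0//;
    have [_ /(_ x)/andP[]] := cQ.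
Qed.

Lemma form_ge Q u : coefficient Q -> H u -> a * ip mu u u <= form Q u u.
Proof.
move=> cQ Hu; have /andP[+ _] := form_bounds cQ Hu; apply: le_trans.
by rewrite lerDr mulr_ge0 ?ip_ge0// ltW.
Qed.

Lemma form_ge0 Q u : coefficient Q -> H u -> 0 <= form Q u u.
Proof.
by move=> cQ Hu; apply: le_trans (form_ge cQ Hu); rewrite mulr_ge0 ?ip_ge0// ltW.
Qed.

Lemma weak_solution Q g : coefficient Q -> g \in Lfun mu 2%:E ->
  exists2 u, H u & forall v, H v -> form Q u v = ip mu g v.
Proof.
move=> cQ Lg; apply: (@riesz_representation _ _ H (form Q)).
- exact: energy_on0.
- by move=> u v t; exact: energy_on_lin.
- by move=> u v _ _; exact: formC.
- by move=> u v w t; exact: form_linl.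
- by move=> u v t [[Lu _] _] [[Lv _] _]; exact: ip_linr.
- by move=> u; exact: form_ge0.
(* From a |u - g/a|^2 >= 0 and the coercivity of the form. *)
- exists (ip mu g g / a) => u Hu; have [[Lu _] _] := Hu.
  have := form_ge cQ Hu.
  have := ip_ge0 mu (fun x => u x + - a^-1 * g x).
  have Lw : (fun x => u x + - a^-1 * g x) \in Lfun mu 2%:E by exact: Lfun2_lin.
  rewrite ip_linl// !ip_linr// (ipC mu u g) -(pmulr_rge0 _ a_gt0).
  set X := ip mu u u; set Y := ip mu g u; set Z := ip mu g g.
  have -> : a * (X + - a^-1 * Y + - a^-1 * (Y + - a^-1 * Z)) =
      a * X - 2 * Y + Z / a by field; rewrite gt_eqF.
  by move=> h1 h2; lra.
- move=> v_ Hv vC.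
  have Hd n m : H (fun x => v_ m x + -1 * v_ n x) by exact: energy_on_lin.
  have a1 : 0 < a^-1 by rewrite invr_gt0.
  have c1 : 0 < c^-1 by rewrite invr_gt0.
  (* The form bounds the squared L^2 norm up to 1/a and the difference energy up to 1/c; the sum
     serves for both. *)
  have [||u [Eu uC u0]] := @energy_complete _ _ _ mu kap mkap v_ (a^-1 + c^-1).
  + by move=> n; have [] := Hv n.
  + move=> n m nm w; have /andP[+ _] := form_bounds cQ (Hd n m).
    have := vC _ _ nm; rewrite -/w.
    have := ip_ge0 mu w; have := ip_ge0 mu2 (wd w).
    set X := ip mu w w; set Y := ip mu2 _ _; set e := 16^-1 ^+ n; set F := form Q w w.
    have e0 : 0 <= e by rewrite exprn_ge0// invr_ge0.
    move=> Y0 X0 Fe FXY; rewrite mulrDl; split.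
      have : X <= a^-1 * e.
        by rewrite ler_pdivlMl//; have := mulr_ge0 (ltW c_gt0) Y0; lra.
      by move/le_trans; apply; rewrite lerDl mulr_ge0// ltW.
    have : Y <= c^-1 * e.
      by rewrite ler_pdivlMl//; have := mulr_ge0 (ltW a_gt0) X0; lra.
    by move/le_trans; apply; rewrite lerDr mulr_ge0// ltW.
  (* The absolute value makes the estimate monotone without information on the sign of [b]. *)
  exists (c * (a^-1 + c^-1) + `|b| * (a^-1 + c^-1)), u.
    split => //; apply/patch_idE => x Ox; apply: u0 => n.
    by have [_ /patch_idE/(_ x Ox)] := Hv n.
  move=> n; have Hw : H (fun x => u x + -1 * v_ n x).
    apply: energy_on_lin => //; split => //; apply/patch_idE => x Ox; apply: u0 => k.
    by have [_ /patch_idE/(_ x Ox)] := Hv k.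
  have /andP[_ +] := form_bounds cQ Hw; move/le_trans; apply.
  have [w1 w2] := uC n; rewrite mulrDl -!mulrA; apply: lerD.
    by rewrite ler_pM2l.
  apply: (@le_trans _ _ (`|b| * ip mu (fun x => u x + -1 * v_ n x) (fun x => u x + -1 * v_ n x))).
    by rewrite ler_wpM2r ?ip_ge0// ler_norm.
  by rewrite ler_wpM2l.
Qed.

Lemma weak_solution_unique Q u v : coefficient Q -> H u -> H v ->
  (forall w, H w -> form Q u w = form Q v w) -> {ae mu, forall x, u x = v x}.
Proof.
move=> cQ Hu Hv uv; have Hw := energy_on_lin (-1) Hu Hv.
have : form Q (fun x => u x + -1 * v x) (fun x => u x + -1 * v x) = 0.
  by rewrite form_linl// uv// mulN1r subrr.
move=> F0; have := form_ge cQ Hw; rewrite F0 pmulr_rle0// => le0.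
have /ip_eq0 : ip mu (fun x => u x + -1 * v x) (fun x => u x + -1 * v x) = 0.
  by apply/le_anti; rewrite le0 ip_ge0.
have [[Lw _] _] := Hw.
by move=> /(_ Lw); apply: filterS => x /eqP; rewrite mulN1r subr_eq0 => /eqP.
Qed.

Lemma form_addl Q h u v t : (exists M : R, forall x, `|h x| <= M) -> measurable_fun setT h ->
  coefficient Q -> H u -> H v ->
  form (fun x => Q x + t * h x) u v = form Q u v + t * ip mu (fun x => h x * u x) v.
Proof.
move=> [M hM] mh cQ [[Lu _] _] [[Lv _] _].
rewrite /form (_ : (fun x => _ * u x) = fun x => Q x * u x + t * (h x * u x)).
  by rewrite ip_linl ?addrA// ?(coefM cQ)// (Lfun2_coef mh hM).
by apply/funext => x; ring.
Qed.

Lemma ip_young (f g : T -> R) t : 0 < t -> f \in Lfun mu 2%:E -> g \in Lfun mu 2%:E ->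
  - (t^-1 * ip mu f f + t * ip mu g g) <= 2 * ip mu f g.
Proof.
move=> t0 Lf Lg.
have : `|2 * ip mu f g| <= t^-1 * ip mu f f + t * ip mu g g.
  apply: (@form_young R T [set u | u \in Lfun mu 2%:E]) => //.
  - by move=> u v k; exact: Lfun2_lin.
  - by move=> u v _ _; exact: ipC.
  - by move=> u v w k; exact: ip_linl.
  - by move=> u _; exact: ip_ge0.
by rewrite ler_norml => /andP[].
Qed.

(* With w = u_t - u, testing the equation of u_t with w gives |w| = O(t), while
   the adjoint equation gives (u - g, w) = - t (h u_t, p). *)
Lemma adjoint_first_order (lambda : R) Q h u p (F g QO hO : T -> R) :
  coefficient Q -> (exists M : R, forall x, `|h x| <= M) -> measurable_fun setT h ->
  g \in Lfun mu 2%:E ->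
  QO \in Lfun mu 2%:E -> hO \in Lfun mu 2%:E -> H u -> H p ->
  (forall v, H v -> form Q u v = ip mu F v) ->
  (forall v, H v -> form Q p v = ip mu (fun x => u x + -1 * g x) v) ->
  exists2 K : R, 0 <= K & forall (t : R) ut, 0 < t -> H ut ->
    coefficient (fun x => Q x + t * h x) ->
    (forall v, H v -> form (fun x => Q x + t * h x) ut v = ip mu F v) ->
    2^-1 * ip mu (fun x => u x + -1 * g x) (fun x => u x + -1 * g x) +
      lambda / 2 * ip mu QO QO <=
    2^-1 * ip mu (fun x => ut x + -1 * g x) (fun x => ut x + -1 * g x) +
      lambda / 2 * ip mu (fun x => QO x + t * hO x) (fun x => QO x + t * hO x) ->
    - (t * K) <= lambda * ip mu QO hO - ip mu (fun x => h x * u x) p.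
Proof.
move=> cQ bh mh Lg LQO LhO Hu Hp uE pE.
have [M hM] := bh.
have [[Lu _] _] := Hu; have [[Lp _] _] := Hp.
have Lhu := Lfun2_coef mh hM Lu; have Lhp := Lfun2_coef mh hM Lp.
pose X := ip mu (fun x => h x * u x) (fun x => h x * u x).
pose Y := ip mu (fun x => h x * p x) (fun x => h x * p x).
pose Z := ip mu hO hO.
have X0 : 0 <= X by exact: ip_ge0.
have Y0 : 0 <= Y by exact: ip_ge0.
have Z0 : 0 <= Z by exact: ip_ge0.
have a2 : 0 < a ^+ 2 by rewrite exprn_gt0.
pose K1 := X / a ^+ 2.
have K10 : 0 <= K1 by rewrite divr_ge0// ltW.
(* [K1] bounds |w|^2 / t^2, which occurs half in the cost and half in Young's inequality for (w, h
   p); Y / 2 is the rest of that inequality, and the last term is the quadratic part of the control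
   cost. *)
exists (K1 + Y / 2 + `|lambda| / 2 * Z).
  by rewrite !addr_ge0// ?mulr_ge0 ?invr_ge0.
move=> t ut t0 Hut cQt utE le_cost.
have [[Lut _] _] := Hut.
pose w x := ut x + -1 * u x.
have Hw : H w by exact: energy_on_lin.
have [[Lw _] _] := Hw.
have Lhut := Lfun2_coef mh hM Lut; have Lhw := Lfun2_coef mh hM Lw.
have Ew1 : form (fun x => Q x + t * h x) w w = - (t * ip mu (fun x => h x * u x) w).
  by rewrite form_linl// utE// form_addl// uE//; ring.
have Ew2 : form Q w p = - (t * ip mu (fun x => h x * ut x) p).
  rewrite form_linl// uE//; have := utE p Hp; rewrite form_addl// => <-; ring.
have wE x : w x = ut x + -1 * u x by [].
clearbody w.
(* Coercivity gives a |w|^2 <= - t (h u, w), and the right side is absorbed by completing the square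
   |w + (t/a) h u|^2 >= 0. *)
have wK : ip mu w w <= t ^+ 2 * K1.
  have := form_ge cQt Hw; rewrite Ew1.
  have := ip_ge0 mu (fun x => w x + (t / a) * (h x * u x)).
  have Lz : (fun x => w x + (t / a) * (h x * u x)) \in Lfun mu 2%:E by exact: Lfun2_lin.
  rewrite ip_linl// !ip_linr// (ipC mu w (fun x => h x * u x)) -/X.
  set W := ip mu w w; set V := ip mu (fun x => h x * u x) w => p1 p2.
  have {}p1 : 0 <= a ^+ 2 * W + 2 * a * (t * V) + t ^+ 2 * X.
    have := mulr_ge0 (ltW a2) p1.
    set r := (X in 0 <= X -> _).
    have -> // : r = a ^+ 2 * W + 2 * a * (t * V) + t ^+ 2 * X.
    by rewrite /r; field; rewrite gt_eqF.
  rewrite /K1 mulrA ler_pdivlMr//.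
  have := ler_wpM2l (ltW a_gt0) p2.
  by rewrite mulrN; nra.
(* The adjoint equation tested with [w] equals, by symmetry, the difference of the state equations
   tested with [p]; then u_t = u + w separates the second-order term. *)
have E1 : ip mu (fun x => u x + -1 * g x) w =
    - (t * ip mu (fun x => h x * u x) p) - t * ip mu w (fun x => h x * p x).
  rewrite -pE// formC Ew2.
  have -> : ip mu (fun x => h x * ut x) p =
      ip mu (fun x => h x * u x) p + ip mu w (fun x => h x * p x).
    rewrite (ipC mu w) (ip_mulC h p) (_ : (fun x => h x * ut x) =
      fun x => h x * u x + 1 * (h x * w x)); last by apply/funext => x; rewrite wE; ring.
    by rewrite ip_linl// mul1r.
  ring.
have Lug : (fun x => u x + -1 * g x) \in Lfun mu 2%:E by exact: Lfun2_lin.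
move: le_cost.
rewrite (_ : (fun x => ut x + -1 * g x) = fun x => (u x + -1 * g x) + 1 * w x); last first.
  by apply/funext => x; rewrite wE; ring.
have L1 : (fun x => (u x + -1 * g x) + 1 * w x) \in Lfun mu 2%:E by exact: Lfun2_lin.
have L2 : (fun x => QO x + t * hO x) \in Lfun mu 2%:E by exact: Lfun2_lin.
rewrite (ip_linl 1 Lug Lw L1) (ip_linr 1 Lug Lw Lug) (ip_linr 1 Lug Lw Lw).
rewrite (ipC mu w (fun x => u x + -1 * g x)) E1 (ip_linl t LQO LhO L2) !ip_linr// (ipC mu hO) -/Z.
have := ip_young t0 Lw Lhp; rewrite -/Y.
set D := ip mu (fun x => u x + -1 * g x) (fun x => u x + -1 * g x).
set V := ip mu (fun x => h x * u x) p; set U := ip mu w (fun x => h x * p x); set W := ip mu w w.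
set q1 := ip mu QO QO; set q2 := ip mu QO hO => yo le_cost.
have tW : t^-1 * W <= t * K1 by rewrite ler_pdivrMl// mulrA -expr2.
have lZ : t * (lambda / 2 * Z) <= t * (`|lambda| / 2 * Z).
  by rewrite ler_pM2l// ler_wpM2r// ler_wpM2r ?invr_ge0// ler_norm.
have : 0 <= t * (lambda * q2 - V - U + t^-1 * W / 2 + t * (lambda / 2 * Z)).
  rewrite !(mulrDr t) !mulrN (mulrA t (t^-1 * W)) (mulrA t t^-1) mulfV ?gt_eqF// mul1r.
  by move: le_cost; nra.
rewrite pmulr_rge0//; lra.
Qed.

End weak_solutions.

Lemma ge0_of_small_perturbation (R : realFieldType) (X K t0 : R) :
  0 < t0 -> 0 <= K -> (forall t, 0 < t <= t0 -> - (t * K) <= X) -> 0 <= X.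
Proof.
move=> t00 K0 tX; rewrite leNgt; apply/negP => Xlt.
have K1 : 0 < K + 1 by rewrite ltr_wpDl.
(* For negative X this step gives t (K + 1) <= -X, while the hypothesis gives -X <= t K; K + 1 keeps
   the denominator positive. *)
pose t := Num.min t0 (- X / (K + 1)).
have t_gt0 : 0 < t by rewrite lt_min t00 divr_gt0// oppr_gt0.
have tE : t * (K + 1) <= - X by rewrite -ler_pdivlMr// ge_min lexx orbT.
have : t <= t0 by rewrite ge_min lexx.
move=> /(conj t_gt0)/andP/tX; nra.
Qed.

(** * The fractional energy space *)

Section fractional_energy.
Context {R : realType} {d : nat} (s : R).
Implicit Types (u v : 'rV[R]_d -> R) (Omega : set 'rV[R]_d).
Local Notation leb := (lebesgue_rV R d).
Local Notation leb2 := (lebesgue_rV R d \x lebesgue_rV R d)%E.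

(* The square root of the Gagliardo kernel. *)
Definition sqrt_kernel (z : 'rV[R]_d * 'rV[R]_d) : R :=
  enorm (z.1 - z.2) `^ (- ((d%:R + 2 * s) / 2)).

(** The diagonal is no exception, since 0 to a nonzero power and the inverse of 0 are both 0 by
    convention. *)
Lemma sqrt_kernel_sqr x y :
  sqrt_kernel (x, y) ^+ 2 = (enorm (x - y) `^ (d%:R + 2 * s))^-1.
Proof.
rewrite /sqrt_kernel/= -powR_mulrn ?powR_ge0// -powRrM -powRN.
by congr (_ `^ _); lra.
Qed.

Lemma measurable_sqrt_kernel : measurable_fun setT sqrt_kernel.
Proof.
apply: (measurableT_comp (f := @powR R ^~ _)); first exact: measurable_powR.
have sqrtE (x : 'rV[R]_d) : enorm x = (\sum_(i < d) x 0 i ^+ 2) `^ (2^-1).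
  by rewrite powR12_sqrt// sumr_ge0// => i _; exact: sqr_ge0.
under eq_fun do rewrite sqrtE.
apply: (measurableT_comp (f := @powR R ^~ _)); first exact: measurable_powR.
apply: measurable_sum => i; apply: measurable_funX.
rewrite (_ : (fun z => _) = fun z : 'rV[R]_d * 'rV[R]_d => rV_coord i z.1 - rV_coord i z.2).
  apply: measurable_funB; apply: measurableT_comp;
    by [exact: measurable_rV_coord|exact: measurable_fst|exact: measurable_snd].
by apply/funext => z; rewrite /rV_coord !mxE.
Qed.

Local Notation wd := (wdiff sqrt_kernel).
Local Notation energy := (energy_space leb sqrt_kernel).

Lemma gagliardo_finiteP v : measurable_fun setT v ->
  gagliardo_finite s v <-> wd v \in Lfun leb2 2%:E.
Proof.
move=> mv; have mw := measurable_wdiff measurable_sqrt_kernel mv.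
rewrite Lfun2P /gagliardo_finite.
have -> : (\int[leb2]_z (wd v z ^+ 2)%:E = \int[leb]_y \int[leb]_x
     (`|v x - v y| ^+ 2 / enorm (x - y) `^ (d%:R + 2 * s))%:E)%E.
  rewrite fubini_tonelli2.
  - apply: eq_integral => y _; apply: eq_integral => x _.
    by rewrite /wdiff exprMn sqrt_kernel_sqr real_normK// num_real.
  - by apply/measurable_EFinP; exact: measurable_funX.
  - by move=> z; rewrite lee_fin sqr_ge0.
by split => // -[].
Qed.

(** Fubini's theorem applies because a product of two L^2 functions is integrable; hence [fine] in
    [fracA] discards nothing. *)
Lemma fracA_ip u v : energy u -> energy v ->
  fracA s u v = @fracC R d s / 2 * ip leb2 (wd u) (wd v).
Proof.
move=> [_ Du] [_ Dv]; congr (_ * fine _).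
rewrite -(integral21_prod_meas1 (ip_integrable Du Dv)).
apply: eq_integral => y _; apply: eq_integral => x _ /=.
by rewrite /wdiff/= mulrACA -expr2 sqrt_kernel_sqr.
Qed.

(** From left to right, [v] and its restriction agree off a null set and so have the same energy;
    from right to left, [u] is its own extension. *)
Lemma HtildeE Omega : open Omega -> lipschitz_boundary Omega ->
  Htilde s Omega = energy_on leb sqrt_kernel Omega.
Proof.
move=> oO lO; have mO := open_measurable_rV oO.
have patchT' (v : 'rV[R]_d -> R) : v \_ setT = v.
  by apply/funext => x; rewrite patchE in_setT.
apply/seteqP; split => [_ [v [[L2v gv] sv] <-]|u [[Lu Du] uO]].
  move: L2v; rewrite /L2/= patchT' => Lv.
  have mv := Lfun2_measurable Lv; split; last first.
    by apply/patch_idE => x Ox; rewrite patchE memNset.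
  apply: (energy_ae_eq measurable_sqrt_kernel _ _ (u := v)).
  - by apply/(measurable_restrictT v mO); exact: measurable_funTS.
  (* Each point of [A] is outside the essential support, hence has a neighbourhood where [v] is zero
     almost everywhere; [negligible_locally] makes this global. *)
  - pose A := [set x | ~ closure Omega x /\ v x != 0].
    have nA : leb.-negligible A.
      apply: negligible_locally => x [clx vx].
      have : ~ ess_support v x by move=> /sv.
      move=> /contrapT[U [oU vU] Ux]; exists U; first exact: open_nbhs_nbhs.
      by apply: negligibleS vU => y [[_ vy] Uy] /= /(_ Uy)/eqP; rewrite (negbTE vy).
    apply: (@negligibleS _ _ _ _ (boundary Omega `|` A)); last first.
      by apply: negligibleU => //; exact: boundary_negligible.
    move=> x /= vx; have Ox : ~ Omega x.
      by move=> Ox; apply: vx; rewrite patchE mem_set.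
    have [clx|clx] := pselect (closure Omega x).
      by left; split => // /interior_subset.
    right; split => //; apply/eqP => v0; apply: vx.
    by rewrite patchE memNset.
  - by split => //; apply/gagliardo_finiteP.
exists u => //; split; first split.
- by rewrite /L2/= patchT'.
- by apply/gagliardo_finiteP => //; exact: Lfun2_measurable Lu.
move=> x; apply: contra_notP => clx.
exists (~` closure Omega) => //; split.
  by apply: closed_openC; exact: closed_closure.
apply: aeW => y cy; rewrite -uO patchE memNset//.
by move=> Oy; apply: cy; exact: subset_closure.
Qed.

End fractional_energy.

(** * The control problem *)

Section control.
Context {R : realType} {d : nat} (Omega : set 'rV[R]_d).
Hypothesis mO : measurable Omega.
Implicit Types (F G q u v : 'rV[R]_d -> R).
Local Notation leb := (lebesgue_rV R d).

Lemma patchM F G : (F \* G) \_ Omega = (F \_ Omega) \* (G \_ Omega).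
Proof. by apply/funext => x; rewrite /= !patchE; case: ifPn; rewrite // mul0r. Qed.

Lemma measurable_patch F : measurable_fun setT F -> measurable_fun setT (F \_ Omega).
Proof. by move=> mF; apply/(measurable_restrictT F mO); exact: measurable_funTS. Qed.

(** Replaces integrals over Omega of functions known only almost everywhere there by inner products
    over R^d. Only the product f g has to vanish off Omega, so one factor may be a coefficient that
    does not. *)
Lemma L2dotE F G (f g : 'rV[R]_d -> R) :
  measurable_fun setT (F \_ Omega) -> measurable_fun setT (G \_ Omega) ->
  measurable_fun setT f -> measurable_fun setT g ->
  {ae leb, forall x, Omega x -> F x = f x} ->
  {ae leb, forall x, Omega x -> G x = g x} ->
  (forall x, ~ Omega x -> f x * g x = 0) ->
  L2dot Omega F G = ip leb f g.
Proof.
move=> mF mG mf mg Ff Gg fg0.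
rewrite /L2dot Rintegral_mkcond; congr fine; apply: ae_eq_integral => //.
- apply/measurable_EFinP; rewrite -/(F \* G) patchM; exact: measurable_funM.
- by apply/measurable_EFinP; exact: measurable_funM.
- apply: filterS2 Ff Gg => x Fx Gx _; congr EFin; rewrite patchE.
  case: ifPn => [|]; first by rewrite inE => Ox; rewrite Fx// Gx.
  by rewrite notin_setE => /fg0.
Qed.

Lemma L2norm_ge0 F : 0 <= L2norm Omega F.
Proof. by rewrite /L2norm fine_ge0// Lnorm_ge0. Qed.

Lemma L2norm_sqr F (f : 'rV[R]_d -> R) : measurable_fun setT (F \_ Omega) ->
  f \in Lfun leb 2%:E -> {ae leb, forall x, (F \_ Omega) x = f x} ->
  L2norm Omega F ^+ 2 = ip leb f f.
Proof.
move=> mF Lf Ff; have Ff' : {ae leb, forall x, f x = (F \_ Omega) x}.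
  by apply: filterS Ff => x ->.
have LF : F \_ Omega \in Lfun leb 2%:E by exact: Lfun2_ae_eq Lf Ff'.
have -> : ip leb f f = ip leb (F \_ Omega) (F \_ Omega).
  congr fine; apply: ae_eq_integral => //.
  - by apply/measurable_EFinP; apply: measurable_funM; exact: Lfun2_measurable Lf.
  - by apply/measurable_EFinP; exact: measurable_funM.
  - by apply: filterS Ff => x -> _.
apply: EFin_inj; rewrite ip_sqrE// -Lnorm2_sqr /L2norm.
have fin : ('N[leb]_2%:E [EFin \o F \_ Omega])%E \is a fin_num.
  rewrite ge0_fin_numE ?Lnorm_ge0//.
  by move: LF; rewrite inE => /andP[_]; rewrite inE.
by rewrite -[in RHS](fineK fin) poweR_EFin powR_mulrn// fine_ge0// Lnorm_ge0.
Qed.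

Lemma Lfun2_bounded (M : R) F : (leb Omega < +oo)%E -> measurable_fun setT F ->
  (forall x, `|F x| <= M) -> F \_ Omega \in Lfun leb 2%:E.
Proof.
move=> Ofin mF FM.
have L1 : (\1_Omega : 'rV[R]_d -> R) \in Lfun leb 2%:E.
  apply/Lfun2P; split => //.
  rewrite (_ : (\int[leb]_x _)%E = (\int[leb]_x (\1_Omega x)%:E)%E).
    by rewrite integral_indic// setIT.
  by apply: eq_integral => x _; rewrite indicE; case: (_ \in _); rewrite ?expr1n ?expr0n.
apply: (@Lfun2_dom _ _ _ _ _ \1_Omega M) => //; first exact: measurable_patch.
apply: aeW => x; rewrite patchE indicE; case: ifPn => _.
  by rewrite normr1 mulr1.
by rewrite !normr0 mulr0.
Qed.

(** Clamping to [a, b] alters [q] on a null subset of Omega only, and yields the bounds off Omega as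
    well, where [q] is arbitrary. *)
Lemma Qad_coefficient (a b : R) q : a <= b -> Qad Omega a b q ->
  exists Q, [/\ coefficient a b Q & {ae leb, forall x, Omega x -> q x = Q x}].
Proof.
move=> ab [Lq abq].
have mq : measurable_fun setT (q \_ Omega).
  by move: Lq; rewrite /Loo/= inE => /andP[]; rewrite inE.
exists (fun x => Num.max a (Num.min b ((q \_ Omega) x))); split; first split.
- by apply: measurable_maxr => //; exact: measurable_minr.
- by move=> x; rewrite le_max lexx/= ge_max ab/= ge_min lexx.
- apply: filterS abq => x abq Ox; have /andP[aq qb] := abq Ox.
  by rewrite patchE mem_set// min_r// max_r.
Qed.

Lemma Qad_convex (a b : R) q1 q2 (t : R) : 0 <= t <= 1 ->
  Qad Omega a b q1 -> Qad Omega a b q2 ->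
  Qad Omega a b (fun x => q1 x + t * (q2 x - q1 x)).
Proof.
move=> /andP[t0 t1] [L1 ab1] [L2 ab2]; split.
  have h : (1 <= +oo :> \bar R)%E by rewrite leey.
  have [_ lin] := Lfun_submod_closed leb h.
  rewrite /Loo/= (_ : _ \_ _ = t *: ((-1) *: q1 \_ Omega + q2 \_ Omega) + q1 \_ Omega).
    by apply: (lin) => //; exact: lin.
  apply/funext => x /=.
  rewrite -[RHS]/(t * (-1 * (q1 \_ Omega) x + (q2 \_ Omega) x) + (q1 \_ Omega) x).
  by rewrite !patchE; case: ifPn => _; ring.
apply: filterS2 ab1 ab2 => x ab1 ab2 Ox.
have /andP[a1 b1] := ab1 Ox; have /andP[a2 b2] := ab2 Ox.
by apply/andP; split; nra.
Qed.

End control.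

(** * State and adjoint equations as weak problems *)

Section state_equation.
Context {R : realType} {d : nat} (s : R) (Omega : set 'rV[R]_d).
Hypotheses (s01 : 0 < s < 1) (oO : open Omega) (lO : lipschitz_boundary Omega).
Variables (a b : R).
Hypothesis a_gt0 : 0 < a.
Local Notation leb := (lebesgue_rV R d).
Local Notation H := (energy_on leb (sqrt_kernel s) Omega).
Local Notation frm := (form leb (sqrt_kernel s) (fracC (d := d) s / 2)).
Implicit Types (f q Q u v p : 'rV[R]_d -> R).

Let mO : measurable Omega. Proof. exact: open_measurable_rV. Qed.

Lemma energy_on_measurable u : H u -> measurable_fun setT u.
Proof. by move=> [[Lu _] _]; exact: Lfun2_measurable Lu. Qed.

Lemma L2dot_patch f v : L2 Omega f -> H v -> L2dot Omega f v = ip leb (f \_ Omega) v.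
Proof.
move=> Lf Hv; have [_ v0] := Hv; have mv := energy_on_measurable Hv.
have mf : measurable_fun setT (f \_ Omega) by exact: Lfun2_measurable Lf.
apply: L2dotE => //; first by rewrite v0.
- by apply: aeW => x Ox; rewrite patchE mem_set.
- exact: aeW.
- by move=> x Ox; rewrite patchE memNset// mul0r.
Qed.

Lemma L2dot_coefficient q Q u v : Qad Omega a b q -> coefficient a b Q ->
  {ae leb, forall x, Omega x -> q x = Q x} -> H u -> H v ->
  L2dot Omega (q \* u) v = ip leb (fun x => Q x * u x) v.
Proof.
move=> [Lq _] [mQ _] qQ Hu Hv.
have mu := energy_on_measurable Hu; have mv := energy_on_measurable Hv.
have [_ u0] := Hu; have [_ v0] := Hv.
have mq : measurable_fun setT (q \_ Omega).
  by move: Lq; rewrite /Loo/= inE => /andP[]; rewrite inE.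
apply: L2dotE => //.
- by rewrite patchM u0; exact: measurable_funM.
- by rewrite v0.
- exact: measurable_funM.
- by apply: filterS qQ => x qQ Ox /=; rewrite qQ.
- exact: aeW.
- by move=> x Ox; move/patch_idE : v0 => ->//; rewrite mulr0.
Qed.

Lemma weak_formE q Q u v : Qad Omega a b q -> coefficient a b Q ->
  {ae leb, forall x, Omega x -> q x = Q x} -> H u -> H v ->
  fracA s u v + L2dot Omega (q \* u) v = frm Q u v.
Proof.
move=> Hq cQ qQ Hu Hv; rewrite (L2dot_coefficient Hq cQ qQ)//.
by have [Eu _] := Hu; have [Ev _] := Hv; rewrite fracA_ip.
Qed.

Let HE : Htilde s Omega = H.
Proof. by apply: HtildeE. Qed.

Lemma is_stateP f q Q u : L2 Omega f -> Qad Omega a b q -> coefficient a b Q ->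
  {ae leb, forall x, Omega x -> q x = Q x} ->
  is_state s Omega f q u <->
  H u /\ forall v, H v -> frm Q u v = ip leb (f \_ Omega) v.
Proof.
move=> Lf Hq cQ qQ; rewrite /is_state HE; split=> -[Hu uE]; split => // v Hv.
  by rewrite -(weak_formE Hq cQ qQ)// uE// L2dot_patch.
by rewrite (weak_formE Hq cQ qQ)// uE// L2dot_patch.
Qed.

Lemma fracA_sym u v : H u -> H v -> fracA s u v = fracA s v u.
Proof. by move=> [Eu _] [Ev _]; rewrite !fracA_ip// ipC. Qed.

(** By symmetry of A, the adjoint equation is a state equation with right-hand side u - u_Omega. *)
Lemma is_adjointP uOmega q Q u p : L2 Omega (u \- uOmega) -> Qad Omega a b q ->
  coefficient a b Q -> {ae leb, forall x, Omega x -> q x = Q x} ->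
  is_adjoint s Omega uOmega q u p <->
  H p /\ forall v, H v -> frm Q p v = ip leb ((u \- uOmega) \_ Omega) v.
Proof.
move=> Lu Hq cQ qQ; rewrite -(is_stateP p Lu Hq cQ qQ) /is_adjoint /is_state HE.
split=> -[Hp pE]; (split; first exact: Hp) => v Hv.
  by rewrite (fracA_sym Hp Hv); exact: pE.
by rewrite (fracA_sym Hv Hp); exact: pE.
Qed.

(** Existence of a weak solution ensures that [xget] returns a solution and not its default
    value. *)
Lemma control_to_stateP f q Q : L2 Omega f -> Qad Omega a b q -> coefficient a b Q ->
  {ae leb, forall x, Omega x -> q x = Q x} ->
  H (control_to_state s Omega f q) /\
  forall v, H v -> frm Q (control_to_state s Omega f q) v = ip leb (f \_ Omega) v.
Proof.
move=> Lf Hq cQ qQ; apply/(is_stateP _ Lf Hq cQ qQ).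
have c0 : 0 < @fracC R d s / 2 by rewrite divr_gt0// fracC_gt0.
have [u Hu uE] := weak_solution (measurable_sqrt_kernel s) Omega c0 a_gt0 cQ Lf.
by apply: xgetPex; exists u; apply/(is_stateP u Lf Hq cQ qQ).
Qed.

End state_equation.

(** * First-order optimality condition *)

Unset Implicit Arguments.

Theorem theorem4p3 (R : realType) (d : nat) (d_ge2 : (2 <= d)%N)
    (Omega : set 'rV[R]_d) (HOmega : bounded_lipschitz_domain Omega)
    (s : R) (s01 : 0 < s < 1) (lambda : R) (lambda_gt0 : 0 < lambda)
    (a b : R) (a_gt0 : 0 < a) (ab : a < b)
    (f uOmega : 'rV[R]_d -> R) (fL2 : L2 Omega f) (uOmegaL2 : L2 Omega uOmega)
    (qbar : 'rV[R]_d -> R)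
    (qbar_opt : locally_optimal s Omega lambda a b f uOmega qbar) :
  let ubar := control_to_state s Omega f qbar in
  exists pbar : 'rV[R]_d -> R,
    [/\ is_adjoint s Omega uOmega qbar ubar pbar,
        forall p : 'rV[R]_d -> R, is_adjoint s Omega uOmega qbar ubar p ->
          p = pbar %[ae lebesgue_rV R d in Omega] &
        forall q : 'rV[R]_d -> R, Qad Omega a b q ->
          0 <= L2dot Omega (fun x => lambda * qbar x - ubar x * pbar x)
                           (q \- qbar)].
Proof.
move=> ubar; have [oO _ _ [M0 [_ OM]] lO] := HOmega.
have mO := open_measurable_rV oO.
have Ofin : (lebesgue_rV R d Omega < +oo)%E.
  apply: (@lebesgue_rV_norm_le R d (M0 + 1)) => // x Ox.
  by apply: (OM (M0 + 1)) => //; rewrite ltrDl.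
have [Hqbar [eta eta0 opt]] := qbar_opt.
have [Qbar [cQbar qQbar]] := Qad_coefficient (ltW ab) Hqbar.
have cst q Q := @control_to_stateP R d s Omega s01 oO lO a b a_gt0 f q Q fL2.
have [Hu uE] := cst _ _ Hqbar cQbar qQbar; rewrite -/ubar in Hu uE.
pose g := uOmega \_ Omega.
have gE u : energy_on (lebesgue_rV R d) (sqrt_kernel s) Omega u ->
    (u \- uOmega) \_ Omega = fun x => u x + -1 * g x.
  move=> [_ /patch_idE u0]; apply/funext => x; rewrite /g !patchE /=.
  by case: ifPn => [_|]; [rewrite mulN1r|rewrite notin_setE => /u0 ->; rewrite mulr0 addr0].
have LgE u : energy_on (lebesgue_rV R d) (sqrt_kernel s) Omega u ->
    L2 Omega (u \- uOmega).
  by move=> Hu'; rewrite /L2/= gE//; apply: Lfun2_lin => //; have [[]] := Hu'.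
have c0 : 0 < @fracC R d s / 2 by rewrite divr_gt0// fracC_gt0.
have mk := @measurable_sqrt_kernel R d s.
have adj (p : 'rV[R]_d -> R) := is_adjointP s oO lO p (LgE _ Hu) Hqbar cQbar qQbar.
have [p Hp pE] := weak_solution mk Omega c0 a_gt0 cQbar (LgE _ Hu).
exists p; split; first exact/adj.
  move=> p' /adj[Hp' pE'].
  have := weak_solution_unique c0 a_gt0 cQbar Hp' Hp.
  move=> /(_ (fun w Hw => etrans (pE' w Hw) (esym (pE w Hw)))).
  by apply: filterS => x + _.
move=> q Hq; have [Q [cQ qQ]] := Qad_coefficient (ltW ab) Hq.
have [mQbar Qbarab] := cQbar; have [mQ Qab] := cQ.
(* The clamped controls are subtracted, so that [h] is bounded at every point. *)
pose h x := Q x - Qbar x.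
have mh : measurable_fun setT h by exact: measurable_funB.
have hM x : `|h x| <= b - a.
  have /andP[? ?] := Qab x; have /andP[? ?] := Qbarab x.
  by rewrite ler_norml; apply/andP; split; rewrite /h; lra.
have Qbarb x : `|Qbar x| <= b by exact: coefficient_norm cQbar.
(* A coefficient is at least [a] on all of R^d, so the control cost uses its restriction to Omega, a
   set of finite measure; hence the separate arguments [QO] and [hO] of [adjoint_first_order]. *)
have LQO := Lfun2_bounded mO Ofin mQbar Qbarb.
have LhO := Lfun2_bounded mO Ofin mh hM.
rewrite gE// in pE.
have [|K K0 main] := adjoint_first_order c0 a_gt0 lambda cQbar _ mh uOmegaL2
  LQO LhO Hu Hp uE pE; first by exists (b - a).
set hh := ip (lebesgue_rV R d) (h \_ Omega) (h \_ Omega).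
have hh0 : 0 <= hh by exact: ip_ge0.
have measurable_Qad q' : Qad Omega a b q' -> measurable_fun setT (q' \_ Omega).
  by move=> [+ _]; rewrite /Loo/= inE => /andP[]; rewrite inE.
have mqbar := measurable_Qad _ Hqbar; have mq := measurable_Qad _ Hq.
have [[Lu _] u0] := Hu; have [[Lp _] p0] := Hp.
have costE u q' (Q' : 'rV[R]_d -> R) :
    energy_on (lebesgue_rV R d) (sqrt_kernel s) Omega u -> Qad Omega a b q' ->
    Q' \in Lfun (lebesgue_rV R d) 2%:E ->
    {ae lebesgue_rV R d, forall x, (q' \_ Omega) x = Q' x} ->
    cost Omega lambda uOmega u q' =
    2^-1 * ip (lebesgue_rV R d) (fun x => u x + -1 * g x) (fun x => u x + -1 * g x)
    + lambda / 2 * ip (lebesgue_rV R d) Q' Q'.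
  move=> Hu' Hq' LQ' qQ'.
  have LD := LgE _ Hu'; rewrite /L2/= gE// in LD.
  rewrite /cost; congr (_ * _ + _ * _).
    apply: L2norm_sqr => //; last by apply: aeW => x; rewrite gE.
    by rewrite gE//; exact: Lfun2_measurable LD.
  by apply: L2norm_sqr => //; exact: measurable_Qad.
have -> : L2dot Omega (fun x => lambda * qbar x - ubar x * p x) (q \- qbar) =
    lambda * ip (lebesgue_rV R d) (Qbar \_ Omega) (h \_ Omega) -
    ip (lebesgue_rV R d) (fun x => h x * ubar x) p.
  rewrite (@L2dotE _ _ _ _ _ (fun x => lambda * (Qbar \_ Omega) x - ubar x * p x) (h \_ Omega)).
  - rewrite /ip -RintegralZl//; last exact: ip_integrable.
    rewrite -RintegralB//; last 2 first.
    + by apply/(@integrableZl _ _ _ _ _ measurableT _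
        (EFin \o (fun x => (Qbar \_ Omega) x * (h \_ Omega) x)))/ip_integrable.
    + by apply: ip_integrable => //; exact: (Lfun2_coef mh hM).
    apply: eq_Rintegral => x _; rewrite !patchE; case: ifPn => [_|]; first by ring.
    by rewrite notin_setE => Ox; move/patch_idE : u0 => ->//; ring.
  - rewrite (_ : _ \_ _ = fun x => lambda * (qbar \_ Omega) x - ubar x * p x).
      apply: measurable_funB; first exact: measurable_funM.
      by apply: measurable_funM; [exact: Lfun2_measurable Lu|exact: Lfun2_measurable Lp].
    apply/funext => x; rewrite !patchE; case: ifPn => //.
    by rewrite notin_setE => Ox; move/patch_idE : u0 => ->//; rewrite mul0r subr0; exact/esym/mulr0.
  - rewrite (_ : _ \_ _ = fun x => (q \_ Omega) x - (qbar \_ Omega) x).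
      exact: measurable_funB.
    by apply/funext => x; rewrite !patchE /=; case: ifPn => // _; exact/esym/subrr.
  - apply: measurable_funB; first by apply: measurable_funM => //; exact: measurable_patch.
    by apply: measurable_funM; [exact: Lfun2_measurable Lu|exact: Lfun2_measurable Lp].
  - exact: measurable_patch.
  - by apply: filterS qQbar => x qx Ox; rewrite patchE mem_set// qx.
  - by apply: filterS2 qQ qQbar => x qx qbx Ox; rewrite patchE mem_set//= qx// qbx.
  - by move=> x Ox; rewrite [X in _ * X]patchE memNset// mulr0.
(* The bound 1 keeps q_t admissible. The other keeps it within eta of qbar: t^2 hh <= t^2 (1 + hh)^2
   <= eta^2, without a square root or a zero denominator. *)
apply: (@ge0_of_small_perturbation R _ K (Num.min 1 (eta / (1 + hh)))) => //.
  by rewrite lt_min ltr01 divr_gt0// ltr_pwDl.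
move=> t /andP[t0]; rewrite le_min => /andP[t1 teta].
pose qt x := qbar x + t * (q x - qbar x).
have t01 : 0 <= t <= 1 by rewrite ltW.
have Hqt : Qad Omega a b qt by exact: Qad_convex.
(* The coefficient is the convex combination of the clamped controls and not a clamp of [qt], so it
   is affine in t. *)
have cQt : coefficient a b (fun x => Qbar x + t * h x).
  split; first by apply: measurable_funD => //; exact: measurable_funM.
  move=> x; have /andP[? ?] := Qab x; have /andP[? ?] := Qbarab x.
  by rewrite /h; apply/andP; split; nra.
have qQt : {ae lebesgue_rV R d, forall x, Omega x -> qt x = Qbar x + t * h x}.
  by apply: filterS2 qQ qQbar => x qx qbx Ox; rewrite /qt /h qx// qbx.
have [Hut utE] := cst _ _ Hqt cQt qQt.
have LQt : (fun x => (Qbar \_ Omega) x + t * (h \_ Omega) x) \in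
    Lfun (lebesgue_rV R d) 2%:E by exact: Lfun2_lin.
have qn : L2norm Omega (qt \- qbar) <= eta.
  have LthO := Lfun2_scale t LhO.
  rewrite -ler_sqr ?nnegrE ?L2norm_ge0 ?(ltW eta0)// (L2norm_sqr _ LthO).
  - rewrite ip_scale_sqr// -/hh; rewrite ler_pdivlMr ?ltr_pwDl// in teta.
    have th0 : 0 <= t * (1 + hh) by rewrite mulr_ge0 ?addr_ge0// ltW.
    have le2 : (t * (1 + hh)) ^+ 2 <= eta ^+ 2.
      by rewrite ler_sqr ?nnegrE// ltW.
    apply: (le_trans _ le2); rewrite exprMn ler_wpM2l ?sqr_ge0//; nra.
  - rewrite (_ : _ \_ _ = fun x => t * ((q \_ Omega) x - (qbar \_ Omega) x)).
      by apply: measurable_funM => //; exact: measurable_funB.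
    apply/funext => x; rewrite !patchE /= /qt; case: ifPn => _; first by ring.
    by rewrite -[RHS]/(t * (0 - 0)) subrr mulr0.
  - apply: filterS2 qQ qQbar => x qx qbx; rewrite !patchE /= /qt; case: ifPn.
      by rewrite inE => Ox; rewrite qx// qbx// /h; ring.
    by rewrite mulr0.
have := opt _ Hqt qn.
rewrite (costE _ _ _ Hu Hqbar LQO); last first.
  apply: filterS qQbar => x qx; rewrite !patchE; case: ifPn => //.
  by rewrite inE => /qx.
rewrite (costE _ _ _ Hut Hqt LQt); last first.
  apply: filterS qQt => x qx; rewrite !patchE; case: ifPn; last by rewrite mulr0 addr0.
  by rewrite inE => /qx.
exact: (main t _ t0 Hut cQt utE).
Qed.
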